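(* If $T$ is a free amalgamation theory then $T$ is $\operatorname{NSOP}_4$.
   Context: Conventions: $T$ is a complete first-order theory with monster model $\mathbb M$ (saturated and strongly homogeneous in a large cardinal $\kappa$); sets are small; $a\equiv_C b$ means some automorphism of $\mathbb M$ fixing $C$ pointwise sends $a$ to $b$; $\operatorname{acl}$ is algebraic closure, and a set or tuple $A$ is closed if $\operatorname{acl}(A)=A$; $AB=A\cup B$. A ternary relation $\mathop{\downarrow}$ on small subsets of $\mathbb M$ is a free amalgamation relation if it satisfies: invariance (if $A\mathop{\downarrow}_C B$ and $\sigma\in\operatorname{Aut}(\mathbb M)$ then $\sigma(A)\mathop{\downarrow}_{\sigma(C)}\sigma(B)$); monotonicity ($A\mathop{\downarrow}_C B$, $A_0\subseteq A$, $B_0\subseteq B$ imply $A_0\mathop{\downarrow}_C B_0$); symmetry; full transitivity (for $D\subseteq C\subseteq B$: $A\mathop{\downarrow}_D B$ iff $A\mathop{\downarrow}_C B$ and $A\mathop{\downarrow}_D C$); full existence (for closed $C$, any $B$ and tuple $a$ there is $a'\equiv_C a$ with $a'\mathop{\downarrow}_C B$); stationarity (for closed $C$ and closed tuples $a,a',b$ with $C\subseteq a\cap b$: if $a\mathop{\downarrow}_C b$, $a'\mathop{\downarrow}_C b$, $a'\equiv_C a$ then $ab\equiv_C a'b$); freedom (if $A\mathop{\downarrow}_C B$ and $C\cap AB\subseteq D\subseteq C$ then $A\mathop{\downarrow}_D B$); closure (for closed $A,B,C$ with $C\subseteq A\cap B$, $A\mathop{\downarrow}_C B$ implies $AB$ closed).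 $T$ is a free amalgamation theory if it has a free amalgamation relation. For $n\geq3$, $T$ has $\operatorname{SOP}_n$ if there is an indiscernible sequence $(a_i)_{i<\omega}$ such that, with $p(x,y)=\operatorname{tp}(a_0,a_1)$, the set $p(x_1,x_2)\cup\dots\cup p(x_{n-1},x_n)\cup p(x_n,x_1)$ is inconsistent; $T$ is $\operatorname{NSOP}_n$ otherwise. *)

(* Defs.v *)
From Stdlib Require Import Vectors.Fin Arith.

Set Implicit Arguments.

Record signature : Type := {
  funs : Type;
  rels : Type;
  farity : funs -> nat;
  rarity : rels -> nat
}.

Record structure (L : signature) : Type := {
  dom :> Type;
  fint : forall f : funs L, (Fin.t (farity L f) -> dom) -> dom;
  rint : forall r : rels L, (Fin.t (rarity L r) -> dom) -> Prop
}.

(** Variables are pairs of naturals: (i, j) is the j-th coordinate of the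
    i-th tuple of variables. *)
Definition var := (nat * nat)%type.
Definition var_eq_dec : forall x y : var, {x = y} + {x <> y}.
Proof. decide equality; apply Nat.eq_dec. Defined.

Section Syntax.
Variable L : signature.

Inductive term (P : Type) : Type :=
| tvar : var -> term P
| tpar : P -> term P
| tapp : forall f : funs L, (Fin.t (farity L f) -> term P) -> term P.
Arguments tvar {P} _. Arguments tpar {P} _. Arguments tapp {P} _ _.

Inductive formula (P : Type) : Type :=
| feq : term P -> term P -> formula P
| frel : forall r : rels L, (Fin.t (rarity L r) -> term P) -> formula P
| fnot : formula P -> formula P
| fand : formula P -> formula P -> formula P
| fex : var -> formula P -> formula P.
Arguments feq {P} _ _. Arguments frel {P} _ _. Arguments fnot {P} _.
Arguments fand {P} _ _. Arguments fex {P} _ _.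

Fixpoint term_fv (P : Type) (t : term P) (x : var) : Prop :=
  match t with
  | tvar y => y = x
  | tpar _ => False
  | tapp f ts => exists i, term_fv (ts i) x
  end.

Fixpoint fv (P : Type) (phi : formula P) (x : var) : Prop :=
  match phi with
  | feq t1 t2 => term_fv t1 x \/ term_fv t2 x
  | frel r ts => exists i, term_fv (ts i) x
  | fnot psi => fv psi x
  | fand p1 p2 => fv p1 x \/ fv p2 x
  | fex y psi => x <> y /\ fv psi x
  end.

Definition sentence (P : Type) (phi : formula P) : Prop := forall x, ~ fv phi x.

Section Sem.
Variable M : structure L.
Variable P : Type.
Variable e : P -> M.

Fixpoint eval (v : var -> M) (t : term P) : M :=
  match t with
  | tvar x => v x
  | tpar p => e p
  | tapp f ts => fint M f (fun i => eval v (ts i))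
  end.

Definition upd (v : var -> M) (x : var) (d : M) : var -> M :=
  fun w => if var_eq_dec w x then d else v w.

Fixpoint sat (v : var -> M) (phi : formula P) : Prop :=
  match phi with
  | feq t1 t2 => eval v t1 = eval v t2
  | frel r ts => rint M r (fun i => eval v (ts i))
  | fnot psi => ~ sat v psi
  | fand p1 p2 => sat v p1 /\ sat v p2
  | fex x psi => exists d : M, sat (upd v x d) psi
  end.
End Sem.
End Syntax.

Arguments feq {L P}. Arguments frel {L P}. Arguments fnot {L P}.
Arguments fand {L P}. Arguments fex {L P}.

Definition noparam (M : Type) : Empty_set -> M := fun z => match z with end.

Section Monster.
Variable L : signature.
Variable M : structure L.

Definition subset (A B : M -> Prop) : Prop := forall x, A x -> B x.
Definition union (A B : M -> Prop) : M -> Prop := fun x => A x \/ B x.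
Definition inter (A B : M -> Prop) : M -> Prop := fun x => A x /\ B x.
Definition range (I : Type) (a : I -> M) : M -> Prop := fun x => exists i, a i = x.

(** Cardinality conventions: the monster has size kappa = |M|; a set or index
    type is small iff its cardinality is < |M|, i.e. M does not inject into it. *)
Definition small_type (I : Type) : Prop :=
  ~ exists f : M -> I, forall x y, f x = f y -> x = y.
Definition small (A : M -> Prop) : Prop := small_type {x : M | A x}.

Definition is_aut (s : M -> M) : Prop :=
  (exists s' : M -> M, (forall x, s' (s x) = x) /\ (forall y, s (s' y) = y)) /\
  (forall f xs, s (fint M f xs) = fint M f (fun i => s (xs i))) /\
  (forall r xs, rint M r xs <-> rint M r (fun i => s (xs i))).

Definition fixes (s : M -> M) (C : M -> Prop) : Prop := forall x, C x -> s x = x.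

Definition image (s : M -> M) (A : M -> Prop) : M -> Prop :=
  fun y => exists x, A x /\ s x = y.

Definition equiv_over (C : M -> Prop) (I : Type) (a b : I -> M) : Prop :=
  exists s, is_aut s /\ fixes s C /\ forall i, s (a i) = b i.

Definition acl (A : M -> Prop) : M -> Prop := fun b =>
  exists phi : formula L {x : M | A x},
    (forall y, fv phi y -> y = (0, 0)) /\
    (forall v, v (0, 0) = b -> sat M (@proj1_sig _ A) v phi) /\
    exists l : list M, forall v, sat M (@proj1_sig _ A) v phi -> List.In (v (0, 0)) l.

Definition closed (A : M -> Prop) : Prop := forall x, acl A x <-> A x.

Definition saturated : Prop :=
  forall (A : M -> Prop), small A ->
  forall Sigma : formula L {x : M | A x} -> Prop,
    (forall phi, Sigma phi -> forall y, fv phi y -> y = (0, 0)) ->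
    (forall l : list (formula L {x : M | A x}),
        (forall phi, List.In phi l -> Sigma phi) ->
        exists v, forall phi, List.In phi l -> sat M (@proj1_sig _ A) v phi) ->
    exists v, forall phi, Sigma phi -> sat M (@proj1_sig _ A) v phi.

Definition strongly_homogeneous : Prop :=
  forall (A : M -> Prop), small A ->
  forall g : {x : M | A x} -> M,
    (forall phi : formula L {x : M | A x}, sentence phi ->
       forall v, sat M (@proj1_sig _ A) v phi <-> sat M g v phi) ->
    exists s, is_aut s /\ forall x : {x : M | A x}, s (proj1_sig x) = g x.

Definition monster : Prop :=
  small_type nat /\ small_type (funs L) /\ small_type (rels L) /\
  saturated /\ strongly_homogeneous.

Definition free_amalgamation_relation
  (ind : (M -> Prop) -> (M -> Prop) -> (M -> Prop) -> Prop) : Prop :=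
  (forall A B C s, small A -> small B -> small C -> is_aut s ->
     ind A C B -> ind (image s A) (image s C) (image s B)) /\
  (forall A B C A0 B0, small A -> small B -> small C ->
     ind A C B -> subset A0 A -> subset B0 B -> ind A0 C B0) /\
  (forall A B C, small A -> small B -> small C -> ind A C B -> ind B C A) /\
  (forall A B C D, small A -> small B -> small C -> small D ->
     subset D C -> subset C B ->
     (ind A D B <-> ind A C B /\ ind A D C)) /\
  (forall (C B : M -> Prop) (I : Type) (a : I -> M),
     small C -> small B -> small_type I -> closed C ->
     exists a' : I -> M, equiv_over C a a' /\ ind (range a') C B) /\
  (forall (C : M -> Prop) (I J : Type) (a a' : I -> M) (b : J -> M),
     small C -> small_type I -> small_type J ->
     closed C -> closed (range a) -> closed (range a') -> closed (range b) ->
     subset C (inter (range a) (range b)) ->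
     ind (range a) C (range b) -> ind (range a') C (range b) ->
     equiv_over C a a' ->
     equiv_over C (I := I + J)
       (fun k => match k with inl i => a i | inr j => b j end)
       (fun k => match k with inl i => a' i | inr j => b j end)) /\
  (forall A B C D, small A -> small B -> small C -> small D ->
     ind A C B -> subset (inter C (union A B)) D -> subset D C -> ind A D B) /\
  (forall A B C, small A -> small B -> small C ->
     closed A -> closed B -> closed C -> subset C (inter A B) ->
     ind A C B -> closed (union A B)).

Definition free_amalgamation_theory : Prop :=
  exists ind, free_amalgamation_relation ind.

(** Indiscernible sequences of k-tuples: a i j is the j-th coordinate (j < k)
    of the i-th tuple. *)
Definition tuple_val (k : nat) (a : nat -> nat -> M) (s : nat -> nat) : var -> M :=
  fun x => a (s (fst x)) (snd x).

Definition strictly_increasing (s : nat -> nat) : Prop := forall m n, m < n -> s m < s n.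

Definition indiscernible (k : nat) (a : nat -> nat -> M) : Prop :=
  forall (s t : nat -> nat), strictly_increasing s -> strictly_increasing t ->
  forall phi : formula L Empty_set,
    (forall x, fv phi x -> snd x < k) ->
    (sat M (noparam M) (tuple_val k a s) phi <-> sat M (noparam M) (tuple_val k a t) phi).

Definition model_of_T (N : structure L) : Prop :=
  inhabited N /\
  forall phi : formula L Empty_set, sentence phi ->
    (forall v, sat M (noparam M) v phi) -> forall w, sat N (noparam N) w phi.

(** The formula phi(x,y) belongs to p(x,y) = tp(a_0,a_1): its free variables are
    among x = ((0,j))_{j<k}, y = ((1,j))_{j<k}, and it holds of (a_0, a_1). *)
Definition in_tp01 (k : nat) (a : nat -> nat -> M) (phi : formula L Empty_set) : Prop :=
  (forall x, fv phi x -> fst x < 2 /\ snd x < k) /\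
  sat M (noparam M) (tuple_val k a (fun i => i)) phi.

(** p(x_1,x_2) ∪ ... ∪ p(x_{n-1},x_n) ∪ p(x_n,x_1) is consistent (with T):
    realized in some model N of T by tuples b_0, ..., b_{n-1}. *)
Definition cycle_consistent (n k : nat) (a : nat -> nat -> M) : Prop :=
  exists (N : structure L) (b : nat -> nat -> N),
    model_of_T N /\
    forall i, i < n -> forall phi, in_tp01 k a phi ->
      sat N (noparam N)
        (fun x : var => b (if Nat.eqb (fst x) 0 then i else (S i) mod n) (snd x)) phi.

Definition SOP (n : nat) : Prop :=
  exists (k : nat) (a : nat -> nat -> M), indiscernible k a /\ ~ cycle_consistent n k a.

Definition NSOP (n : nat) : Prop := ~ SOP n.

End Monster.

(* Main.v *)
(** By automorphisms one reduces to three members a0, a1, a2 of the sequence. Let E_i = acl(a_i)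
    and D = E_0 ∩ E_1. For a finite tuple d from D the copies of d over (a_i, a_j) range over
    finite sets, so by pigeonhole and indiscernibility the set of copies does not depend on i < j.
    Hence some automorphism tau fixes D pointwise and shifts a0 -> a1 -> a2; in particular
    E_1 ∩ E_2 = D, without extending the sequence or replacing it by closed tuples.

    Full existence gives rho fixing E_1 with rho E_2 free from E_0 over E_1, and freedom lowers
    the base to D. Stationarity then makes the pair (E_0, rho E_2) symmetric: some automorphism pi
    swaps a0 and rho a2. The tuples a0, a1, rho a2, pi a1 realize the 4-cycle, because
    rho(a1,a2) = (a1, rho a2), pi(a0,a1) = (rho a2, pi a1) and pi(a1, rho a2) = (pi a1, a0). *)

From Stdlib Require Import Classical ClassicalEpsilon FunctionalExtensionality PropExtensionality.
From Stdlib Require Import List Lia PeanoNat.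
From Stdlib Require Vectors.Fin Cantor.
From mathcomp Require classical_sets.
Require Import Defs.
Import ListNotations.

Set Bullet Behavior "Strict Subproofs".

Arguments tvar {L P} _.
Arguments tpar {L P} _.
Arguments tapp {L P} _ _.

(** * Cardinals *)

(** [small_type M I] is by definition the negation of [embeds M I], so smallness is handled by
    comparing cardinals. *)
Definition embeds (X Y : Type) : Prop := exists f : X -> Y, forall x y, f x = f y -> x = y.

Lemma embeds_trans X Y Z : embeds X Y -> embeds Y Z -> embeds X Z.
Proof.
  intros [f Hf] [g Hg]. exists (fun x => g (f x)). auto.
Qed.

Lemma embeds_of_rel X Y (R : X -> Y -> Prop) :
  (forall x, exists y, R x y) -> (forall x x' y, R x y -> R x' y -> x = x') -> embeds X Y.
Proof.
  intros Htot Hinj. destruct (choice _ Htot) as [f Hf].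
  exists f. intros x x' E. apply (Hinj x x' (f x)); [apply Hf | rewrite E; apply Hf].
Qed.

Lemma predicate_ext T (A B : T -> Prop) : (forall x, A x <-> B x) -> A = B.
Proof.
  intros H. apply functional_extensionality. intros x. apply propositional_extensionality, H.
Qed.

(** The chain [F] may be empty, so [P] has to hold of the empty set; this shapes the property used
    in [embeds_square]. *)
Lemma zorn_union T (P : (T -> Prop) -> Prop) :
  (forall F : (T -> Prop) -> Prop,
     (forall X, F X -> P X) ->
     (forall X Y, F X -> F Y -> (forall t, X t -> Y t) \/ (forall t, Y t -> X t)) ->
     P (fun t => exists X, F X /\ X t)) ->
  exists A, P A /\ forall B : T -> Prop, (forall t, A t -> B t) -> P B -> forall t, B t -> A t.
Proof.
  intros H.
  destruct (@classical_sets.Zorn_bigcup T P) as [A [PA HA]].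
  - intros F FP Ftot.
    match goal with
    | |- P ?U => replace U with (fun t => exists X, F X /\ X t)
    end.
    + apply H; [exact FP|]. intros X Y FX FY. exact (Ftot X Y FX FY).
    + apply predicate_ext. intros t. split.
      * intros [X [FX Xt]]. exists X; auto.
      * intros [X FX Xt]. exists X. auto.
  - exists A. split; [exact PA|].
    intros B AB PB. apply NNPP. intros nBA. apply (HA B); [|exact PB].
    split; [exact AB|]. exact nBA.
Qed.

(** A maximal partial injection is total or onto: missing [x0] in its domain and [y0] in its range,
    it could be enlarged by [(x0, y0)]. *)
Lemma embeds_total X Y : embeds X Y \/ embeds Y X.
Proof.
  pose (P := fun R : X * Y -> Prop =>
    (forall x y y', R (x, y) -> R (x, y') -> y = y') /\
    (forall x x' y, R (x, y) -> R (x', y) -> x = x')).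
  destruct (zorn_union _ P) as [R [[Rfun Rinj] Rmax]].
  { intros F FP Ftot. split.
    - intros x y y' [S [FS Sy]] [S' [FS' Sy']].
      destruct (Ftot S S' FS FS') as [I|I].
      + apply (proj1 (FP S' FS') x); auto.
      + apply (proj1 (FP S FS) x); auto.
    - intros x x' y [S [FS Sy]] [S' [FS' Sy']].
      destruct (Ftot S S' FS FS') as [I|I].
      + apply (proj2 (FP S' FS') x x' y); auto.
      + apply (proj2 (FP S FS) x x' y); auto. }
  destruct (classic (forall x, exists y, R (x, y))) as [Htot|Hx].
  { left. apply (embeds_of_rel X Y (fun x y => R (x, y))); auto. }
  destruct (classic (forall y, exists x, R (x, y))) as [Hsur|Hy].
  { right. apply (embeds_of_rel Y X (fun y x => R (x, y))); eauto. }
  exfalso.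
  apply not_all_ex_not in Hx. destruct Hx as [x0 Hx].
  apply not_all_ex_not in Hy. destruct Hy as [y0 Hy].
  apply Hx. exists y0.
  apply (Rmax (fun p => R p \/ p = (x0, y0))); [auto| |auto].
  split.
  - intros x y y' [H|H] [H'|H'].
    + eauto.
    + inversion H'; subst. exfalso; eauto.
    + inversion H; subst. exfalso; eauto.
    + congruence.
  - intros x x' y [H|H] [H'|H'].
    + eauto.
    + inversion H'; subst. exfalso; eauto.
    + inversion H; subst. exfalso; eauto.
    + congruence.
Qed.

(** * Infinite sets absorb their squares *)

Section Hessenberg.
Variable Y : Type.

Definition square_dom (G : Y * Y * Y -> Prop) (x : Y) : Prop := exists z, G (x, x, z).

(* [G] is the graph of an injection [S * S -> S], where [S] is read off the diagonal. *)
Definition square_graph (G : Y * Y * Y -> Prop) : Prop :=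
  (forall x y z, G (x, y, z) -> square_dom G x /\ square_dom G y /\ square_dom G z) /\
  (forall x y, square_dom G x -> square_dom G y -> exists z, G (x, y, z)) /\
  (forall x y z z', G (x, y, z) -> G (x, y, z') -> z = z') /\
  (forall x y x' y' z, G (x, y, z) -> G (x', y', z) -> x = x' /\ y = y').

Lemma square_graph_nat (n : nat -> Y) :
  (forall i j, n i = n j -> i = j) ->
  square_graph (fun p => exists i j, p = (n i, n j, n (Cantor.to_nat (i, j)))).
Proof.
  intros Hn.
  assert (D : forall i, square_dom
            (fun p => exists i j, p = (n i, n j, n (Cantor.to_nat (i, j)))) (n i)).
  { intros i. exists (n (Cantor.to_nat (i, i))), i, i. reflexivity. }
  split; [|split; [|split]].
  - intros x y z (i & j & E). inversion E; subst. auto.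
  - intros x y (z & i & j & E) (z' & i' & j' & E').
    inversion E; inversion E'; subst.
    exists (n (Cantor.to_nat (i, i'))), i, i'. reflexivity.
  - intros x y z z' (i & j & E) (i' & j' & E').
    inversion E; inversion E'; subst.
    assert (i = i') by auto. assert (j = j') by auto. subst; reflexivity.
  - intros x y x' y' z (i & j & E) (i' & j' & E').
    inversion E; inversion E'; subst.
    assert (E2 : Cantor.to_nat (i, j) = Cantor.to_nat (i', j')) by auto.
    apply Cantor.to_nat_inj in E2. inversion E2; auto.
Qed.

Lemma square_graph_union (F : (Y * Y * Y -> Prop) -> Prop) :
  (forall X, F X -> square_graph X) ->
  (forall X X', F X -> F X' -> (forall t, X t -> X' t) \/ (forall t, X' t -> X t)) ->
  square_graph (fun t => exists X, F X /\ X t).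
Proof.
  intros FP Ftot.
  assert (D : forall X x, F X -> square_dom X x ->
                square_dom (fun t => exists X, F X /\ X t) x).
  { intros X x FX [z Hz]. exists z, X. auto. }
  assert (J : forall X X', F X -> F X' ->
     exists Z, F Z /\ (forall t, X t -> Z t) /\ (forall t, X' t -> Z t)).
  { intros X X' FX FX'. destruct (Ftot X X' FX FX'); [exists X' | exists X]; auto. }
  split; [|split; [|split]].
  - intros x y z (X & FX & Hx).
    destruct (proj1 (FP X FX) x y z Hx) as (A & B & C).
    repeat split; eapply D; eauto.
  - intros x y (z & X & FX & Hx) (z' & X' & FX' & Hx').
    destruct (J X X' FX FX') as (Z & FZ & I & I').
    destruct (FP Z FZ) as (_ & T & _).
    destruct (T x y) as [w Hw]; [exists z; auto | exists z'; auto |].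
    exists w, Z. auto.
  - intros x y z z' (X & FX & Hx) (X' & FX' & Hx').
    destruct (J X X' FX FX') as (Z & FZ & I & I').
    destruct (FP Z FZ) as (_ & _ & T & _). apply (T x y); auto.
  - intros x y x' y' z (X & FX & Hx) (X' & FX' & Hx').
    destruct (J X X' FX FX') as (Z & FZ & I & I').
    destruct (FP Z FZ) as (_ & _ & _ & T). apply (T x y x' y' z); auto.
Qed.

Lemma square_graph_fun (G : Y * Y * Y -> Prop) :
  square_graph G -> exists f : Y -> Y -> Y,
    (forall x y, square_dom G x -> square_dom G y -> G (x, y, f x y) /\ square_dom G (f x y)) /\
    (forall x y x' y', square_dom G x -> square_dom G y -> square_dom G x' -> square_dom G y' ->
       f x y = f x' y' -> x = x' /\ y = y').
Proof.
  intros (Hd & Ht & Hf & Hi).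
  assert (C : exists f : Y * Y -> Y, forall p,
             square_dom G (fst p) -> square_dom G (snd p) -> G (fst p, snd p, f p)).
  { apply choice with (R := fun p z =>
      square_dom G (fst p) -> square_dom G (snd p) -> G (fst p, snd p, z)).
    intros [x y]. simpl.
    destruct (classic (square_dom G x /\ square_dom G y)) as [[A B]|N].
    - destruct (Ht x y A B) as [z Hz]. exists z. auto.
    (* Off the square of the domain the value is an arbitrary default. *)
    - exists x. tauto. }
  destruct C as [f Hfg].
  assert (K : forall x y, square_dom G x -> square_dom G y -> G (x, y, f (x, y))).
  { intros x y A B. apply (Hfg (x, y)); assumption. }
  exists (fun x y => f (x, y)). split.
  - intros x y A B. split; [auto|]. apply (Hd x y); auto.
  - intros x y x' y' A B A' B' E. apply (Hi x y x' y' (f (x, y))); [auto|].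
    rewrite E. auto.
Qed.

(* The three new blocks of [(S + h S)^2] are sent into the disjoint copy [h S],
   tagged by [c0], [c1], [c2]. *)
Lemma square_graph_extend (G : Y * Y * Y -> Prop) (h : Y -> Y) (c0 c1 c2 : Y) :
  square_graph G ->
  square_dom G c0 -> square_dom G c1 -> square_dom G c2 ->
  c0 <> c1 -> c0 <> c2 -> c1 <> c2 ->
  (forall x, square_dom G x -> ~ square_dom G (h x)) ->
  (forall x y, square_dom G x -> square_dom G y -> h x = h y -> x = y) ->
  exists G', square_graph G' /\ (forall t, G t -> G' t) /\ square_dom G' (h c0).
Proof.
  intros HG D0 D1 D2 N01 N02 N12 hout hinj.
  destruct (square_graph_fun G HG) as (f & Hf & Hfi).
  destruct HG as (Hd & Ht & Hu & Hi).
  set (S := square_dom G) in *.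
  pose (G' := fun p => G p \/
    (exists x y, S x /\ S y /\ p = (x, h y, h (f c0 (f x y)))) \/
    (exists x y, S x /\ S y /\ p = (h x, y, h (f c1 (f x y)))) \/
    (exists x y, S x /\ S y /\ p = (h x, h y, h (f c2 (f x y))))).
  assert (fS : forall x y, S x -> S y -> S (f x y)) by (intros; apply Hf; auto).
  assert (finj : forall c c' x y x' y', S c -> S c' -> S x -> S y -> S x' -> S y' ->
     h (f c (f x y)) = h (f c' (f x' y')) -> c = c' /\ x = x' /\ y = y').
  { intros c c' x y x' y' Sc Sc' Sx Sy Sx' Sy' E.
    apply hinj in E; auto.
    apply Hfi in E; auto. destruct E as [E1 E2]. apply Hfi in E2; auto. }
  assert (GS : forall x y z, G (x, y, z) -> S x /\ S y /\ S z) by exact Hd.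
  assert (d1 : forall x, S x -> square_dom G' x).
  { intros x [z Hz]. exists z. left. exact Hz. }
  assert (d2 : forall x, S x -> square_dom G' (h x)).
  { intros x Sx. exists (h (f c2 (f x x))). do 3 right. exists x, x. auto. }
  assert (dinv : forall x, square_dom G' x -> S x \/ exists y, S y /\ x = h y).
  { intros x [z [H|[H|[H|H]]]].
    - left. exists z. exact H.
    - destruct H as (a & b & Sa & Sb & E). inversion E; subst. auto.
    - destruct H as (a & b & Sa & Sb & E). inversion E; subst. auto.
    - destruct H as (a & b & Sa & Sb & E). inversion E; subst. eauto. }
  exists G'. split; [|split; [intros t Ht'; left; exact Ht' | auto]].
  split; [|split; [|split]].
  - intros x y z [H|[H|[H|H]]].
    + destruct (GS x y z H) as (A & B & C). auto.
    + destruct H as (a & b & Sa & Sb & E). inversion E; subst. auto 8.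
    + destruct H as (a & b & Sa & Sb & E). inversion E; subst. auto 8.
    + destruct H as (a & b & Sa & Sb & E). inversion E; subst. auto 8.
  - intros x y Dx Dy.
    destruct (dinv x Dx) as [Sx|(a & Sa & ->)]; destruct (dinv y Dy) as [Sy|(b & Sb & ->)].
    + destruct (Ht x y Sx Sy) as [z Hz]. exists z. left. exact Hz.
    + exists (h (f c0 (f x b))). right. left. exists x, b. auto.
    + exists (h (f c1 (f a y))). do 2 right. left. exists a, y. auto.
    + exists (h (f c2 (f a b))). do 3 right. exists a, b. auto.
  (* The block is determined by which of [x], [y] lie in [S], since [h] maps [S] outside [S]. *)
  - intros x y z z' H H'.
    destruct H as [H|[H|[H|H]]]; destruct H' as [H'|[H'|[H'|H']]];
      try exact (Hu _ _ _ _ H H');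
      try (destruct H as (a & b & Sa & Sb & E); inversion E; subst);
      try (destruct H' as (a' & b' & Sa' & Sb' & E'); inversion E'; subst);
      try (apply GS in H; destruct H as (? & ? & ?));
      try (apply GS in H'; destruct H' as (? & ? & ?));
      try (exfalso; eapply hout; [|eassumption]; assumption);
      try (repeat match goal with
        | K : h ?u = h ?v |- _ => apply hinj in K; [|assumption|assumption]
        end; subst; reflexivity).
  (* The block is determined by [z]: old values lie in [S], new ones in [h S], where the tags [c0],
     [c1], [c2] tell them apart. *)
  - intros x y x' y' z H H'.
    destruct H as [H|[H|[H|H]]]; destruct H' as [H'|[H'|[H'|H']]];
      try exact (Hi _ _ _ _ _ H H');
      try (destruct H as (a & b & Sa & Sb & E); inversion E; subst);
      try (destruct H' as (a' & b' & Sa' & Sb' & E'); inversion E'; subst);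
      try (apply GS in H; destruct H as (? & ? & ?));
      try (apply GS in H'; destruct H' as (? & ? & ?));
      try (exfalso; eapply hout; [|eassumption]; auto; fail);
      try match goal with
        | K : h (f _ _) = h (f _ _) |- _ =>
            apply finj in K; [destruct K as (? & ? & ?); subst; auto; congruence|..]; assumption
        end.
Qed.

(** Take a maximal injection of a square S * S into S. If S embeds in its complement, the injection
    extends, a contradiction; otherwise the complement embeds in S, so all of [Y] embeds in S. *)
Theorem embeds_square : embeds nat Y -> embeds (Y * Y) Y.
Proof.
  intros [n Hn].
  pose (G0 := fun p : Y * Y * Y => exists i j, p = (n i, n j, n (Cantor.to_nat (i, j)))).
  assert (HG0 : square_graph G0) by (apply square_graph_nat; exact Hn).
  (* Containing [G0] is demanded of nonempty [G] only, so that the empty chain passes. *)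
  destruct (zorn_union _ (fun G => square_graph G /\
     ((exists t, G t) -> forall t, G0 t -> G t))) as [G [[HG Hin] Gmax]].
  { intros F FP Ftot. split.
    - apply square_graph_union; [intros X FX; apply FP; exact FX | exact Ftot].
    - intros (t & X & FX & Xt) u Hu. exists X. split; [exact FX|].
      apply (FP X FX); eauto. }
  assert (G0G : forall t, G0 t -> G t).
  { apply Hin. apply NNPP. intros NE.
    apply NE. exists (n 0, n 0, n (Cantor.to_nat (0, 0))).
    apply (Gmax G0); [|split; [exact HG0 | auto] | exists 0, 0; reflexivity].
    intros t Ht. exfalso. eauto. }
  assert (Dn : forall i, square_dom G (n i)).
  { intros i. exists (n (Cantor.to_nat (i, i))). apply G0G. exists i, i. reflexivity. }
  destruct (square_graph_fun G HG) as (f & Hf & Hfi).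
  destruct (embeds_total {x | square_dom G x} {x | ~ square_dom G x}) as [[g Hg]|[g Hg]].
  - exfalso.
    pose (h := fun x => match excluded_middle_informative (square_dom G x) with
       | left D => proj1_sig (g (exist _ x D)) | right _ => x end).
    assert (hE : forall x (D : square_dom G x), h x = proj1_sig (g (exist _ x D))).
    { intros x D. unfold h. destruct (excluded_middle_informative (square_dom G x)) as [D'|N].
      - rewrite (proof_irrelevance _ D' D). reflexivity.
      - contradiction. }
    assert (nn : forall i j, i <> j -> n i <> n j) by (intros i j A B; auto).
    destruct (square_graph_extend G h (n 0) (n 1) (n 2)) as (G' & HG' & GG' & D'); auto.
    + intros x D. rewrite (hE x D). apply proj2_sig.
    + intros x y Dx Dy. rewrite (hE x Dx), (hE y Dy). intros E.
      assert (E2 : g (exist _ x Dx) = g (exist _ y Dy)).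
      { destruct (g (exist _ x Dx)), (g (exist _ y Dy)). simpl in E. subst.
        f_equal. apply proof_irrelevance. }
      apply Hg in E2. congruence.
    + assert (Dh : square_dom G (h (n 0))).
      { destruct D' as [z Hz]. exists z.
        apply (Gmax G' GG'); [split; auto|exact Hz]. }
      rewrite (hE _ (Dn 0)) in Dh.
      exact (proj2_sig (g (exist _ (n 0) (Dn 0))) Dh).
  (* [k] injects [Y] into the domain of [G]: the tag [n 0] marks its own elements, [n 1] the images
     of the others. *)
  - pose (k := fun x => match excluded_middle_informative (square_dom G x) with
       | left D => f (n 0) x | right N => f (n 1) (proj1_sig (g (exist _ x N))) end).
    assert (kS : forall x, square_dom G (k x)).
    { intros x. unfold k. destruct (excluded_middle_informative (square_dom G x)) as [D|N].
      - apply Hf; auto.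
      - apply Hf; auto. apply proj2_sig. }
    assert (ki : forall x y, k x = k y -> x = y).
    { intros x y. unfold k.
      destruct (excluded_middle_informative (square_dom G x)) as [D|N];
      destruct (excluded_middle_informative (square_dom G y)) as [D'|N']; intros E;
      apply Hfi in E; auto; try apply proj2_sig; destruct E as [E1 E2];
      try (apply Hn in E1; discriminate); [exact E2|].
      assert (E3 : g (exist _ x N) = g (exist _ y N')).
      { destruct (g (exist _ x N)), (g (exist _ y N')). simpl in E2. subst.
        f_equal. apply proof_irrelevance. }
      apply Hg in E3. congruence. }
    exists (fun p => f (k (fst p)) (k (snd p))).
    intros [x y] [x' y'] E. simpl in E. apply Hfi in E; auto.
    destruct E as [E1 E2]. apply ki in E1, E2. subst. reflexivity.
Qed.

End Hessenberg.

(** * Formulas *)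

Section Counting.
Variables (L : signature) (P Y : Type).

Lemma embeds_fin_power (n : nat) : embeds nat Y -> embeds (Y * Y) Y -> embeds (Fin.t n -> Y) Y.
Proof.
  intros [num _] [pair Hp]. induction n as [|n [enc IH]].
  - exists (fun _ => num 0). intros f g _.
    apply functional_extensionality. intros i. inversion i.
  - exists (fun f => pair (f Fin.F1, enc (fun i => f (Fin.FS i)))).
    intros f g E. apply Hp in E. inversion E as [[E1 E2]]. apply IH in E2.
    apply functional_extensionality. intros i.
    apply (Fin.caseS' i (fun i => f i = g i)); [exact E1|].
    intros j. exact (f_equal (fun h => h j) E2).
Qed.

(** A constructor is coded by a numeral paired with the codes of its arguments, since [Y] absorbs
    pairs and finite powers. This bounds the size of closures. *)
Lemma embeds_formula :
  embeds nat Y -> embeds (Y * Y) Y -> embeds (funs L) Y -> embeds (rels L) Y -> embeds P Y ->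
  embeds (formula L P) Y.
Proof.
  intros Hnat Hsq [efun Hfun] [erel Hrel] [epar Hpar].
  assert (Hpow : exists enc : forall n, (Fin.t n -> Y) -> Y,
            forall n f g, enc n f = enc n g -> f = g).
  { assert (E := fun n => embeds_fin_power n Hnat Hsq).
    exists (fun n => proj1_sig (constructive_indefinite_description _ (E n))).
    intros n. exact (proj2_sig (constructive_indefinite_description _ (E n))). }
  destruct Hpow as [epow Hpow].
  destruct Hnat as [num Hnum]. destruct Hsq as [pair Hpair].
  pose (tag := fun i y => pair (num i, y)).
  assert (Htag : forall i j y z, tag i y = tag j z -> i = j /\ y = z).
  { intros i j y z E. apply Hpair in E. inversion E as [[E1 E2]]. auto. }
  pose (evar := fun x : var => num (Cantor.to_nat x)).
  assert (Hvar : forall x y, evar x = evar y -> x = y).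
  { intros x y E. apply Hnum, Cantor.to_nat_inj in E. exact E. }
  pose (et := fix et (t : term L P) : Y := match t with
    | tvar x => tag 0 (evar x)
    | tpar p => tag 1 (epar p)
    | tapp f ts => tag 2 (pair (efun f, epow _ (fun i => et (ts i))))
    end).
  assert (Het : forall t u, et t = et u -> t = u).
  { induction t as [x|p|f ts IH]; intros [y|q|g us] E; simpl in E; apply Htag in E;
      destruct E as [E1 E]; try discriminate E1.
    - f_equal. auto.
    - f_equal. auto.
    - apply Hpair in E. inversion E as [[E2 E3]]. apply Hfun in E2. subst g.
      apply Hpow in E3. f_equal. apply functional_extensionality. intros i.
      apply IH. exact (f_equal (fun h => h i) E3). }
  pose (ef := fix ef (phi : formula L P) : Y := match phi with
    | feq t u => tag 0 (pair (et t, et u))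
    | frel r ts => tag 1 (pair (erel r, epow _ (fun i => et (ts i))))
    | fnot psi => tag 2 (ef psi)
    | fand p q => tag 3 (pair (ef p, ef q))
    | fex x psi => tag 4 (pair (evar x, ef psi))
    end).
  exists ef.
  induction x as [t u|r ts|psi IH|p IHp q IHq|x psi IH];
    intros [t' u'|r' ts'|psi'|p' q'|x' psi'] E; simpl in E; apply Htag in E;
    destruct E as [E1 E]; try discriminate E1; try (apply Hpair in E; inversion E as [[E2 E3]]).
  - f_equal; auto.
  - apply Hrel in E2. subst r'. apply Hpow in E3. f_equal.
    apply functional_extensionality. intros i.
    apply Het. exact (f_equal (fun h => h i) E3).
  - f_equal. auto.
  - f_equal; auto.
  - f_equal; auto.
Qed.

End Counting.

(** * Renaming variables and replacing parameters *)

Section Translation.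
Variables (L : signature) (P Q : Type) (rho : var -> var) (g : P -> var + Q).

Fixpoint tr_term (t : term L P) : term L Q :=
  match t with
  | tvar x => tvar (rho x)
  | tpar p => match g p with inl z => tvar z | inr q => tpar q end
  | tapp f ts => tapp f (fun i => tr_term (ts i))
  end.

(** Bound variables are renamed by [rho] too, so its range can be kept away from the variables that
    [g] puts in place of parameters. *)
Fixpoint tr (phi : formula L P) : formula L Q :=
  match phi with
  | feq t u => feq (tr_term t) (tr_term u)
  | frel r ts => frel r (fun i => tr_term (ts i))
  | fnot psi => fnot (tr psi)
  | fand p q => fand (tr p) (tr q)
  | fex x psi => fex (rho x) (tr psi)
  end.

Lemma tr_term_fv (t : term L P) (y : var) :
  term_fv (tr_term t) y -> (exists x, term_fv t x /\ y = rho x) \/ exists p, g p = inl y.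
Proof.
  induction t as [x|p|f ts IH]; simpl; intros H.
  - left. exists x. auto.
  - right. destruct (g p) as [z|q] eqn:E; simpl in H; [|contradiction].
    exists p. rewrite E, H. reflexivity.
  - destruct H as [i Hi]. destruct (IH i Hi) as [(x & Hx & E)|H]; [|auto].
    left. exists x. split; [exists i; exact Hx | exact E].
Qed.

Lemma tr_fv (phi : formula L P) (y : var) :
  fv (tr phi) y -> (exists x, fv phi x /\ y = rho x) \/ exists p, g p = inl y.
Proof.
  induction phi as [t u|r ts|psi IH|p IHp q IHq|x psi IH]; simpl; intros H.
  - destruct H as [H|H]; apply tr_term_fv in H; destruct H as [(x & Hx & E)|H]; eauto.
  - destruct H as [i H]. apply tr_term_fv in H. destruct H as [(x & Hx & E)|H]; eauto.
  - auto.
  - destruct H as [H|H]; [apply IHp in H|apply IHq in H];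
      destruct H as [(x & Hx & E)|H]; eauto.
  - destruct H as [N H]. apply IH in H. destruct H as [(z & Hz & E)|H]; [|auto].
    left. exists z. split; [|exact E]. split; [|exact Hz]. intros ->. auto.
Qed.

Variables (M : structure L) (e : P -> M) (e' : Q -> M).
Hypothesis rho_inj : forall x y, rho x = rho y -> x = y.
Hypothesis rho_fresh : forall p z x, g p = inl z -> rho x <> z.

Definition param_match (w : var -> M) : Prop :=
  forall p, e p = match g p with inl z => w z | inr q => e' q end.

Lemma eval_tr (t : term L P) (v w : var -> M) :
  param_match w -> (forall x, v x = w (rho x)) -> eval M e' w (tr_term t) = eval M e v t.
Proof.
  intros Hw Hv. induction t as [x|p|f ts IH]; simpl.
  - symmetry. apply Hv.
  - rewrite (Hw p). destruct (g p); reflexivity.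
  - f_equal. apply functional_extensionality. exact IH.
Qed.

(** In the quantifier case [rho_fresh] keeps the update off variables that stand for parameters, and
    [rho_inj] keeps it off the other renamed variables. *)
Lemma sat_tr (phi : formula L P) : forall v w : var -> M,
  param_match w -> (forall x, v x = w (rho x)) -> (sat M e' w (tr phi) <-> sat M e v phi).
Proof.
  induction phi as [t u|r ts|psi IH|p IHp q IHq|x psi IH]; intros v w Hw Hv; simpl.
  - rewrite !(eval_tr _ v w Hw Hv). reflexivity.
  - replace (fun i => eval M e' w (tr_term (ts i))) with (fun i => eval M e v (ts i)).
    + reflexivity.
    + apply functional_extensionality. intros i. symmetry. apply eval_tr; auto.
  - rewrite (IH v w Hw Hv). reflexivity.
  - rewrite (IHp v w Hw Hv), (IHq v w Hw Hv). reflexivity.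
  - assert (K : forall d, sat M e' (upd M w (rho x) d) (tr psi) <-> sat M e (upd M v x d) psi).
    { intros d. apply IH.
      - intros p. rewrite (Hw p). destruct (g p) as [z|q] eqn:E; [|reflexivity].
        unfold upd. destruct (var_eq_dec z (rho x)) as [->|N]; [|reflexivity].
        exfalso. exact (rho_fresh p _ x E eq_refl).
      - intros y. unfold upd.
        destruct (var_eq_dec y x) as [E1|N]; destruct (var_eq_dec (rho y) (rho x)) as [E|N'];
          auto; [congruence|].
        apply rho_inj in E. contradiction. }
    split; intros [d Hd]; exists d; apply K; exact Hd.
Qed.

End Translation.

(** * Dependence on variables, parameters and automorphisms *)

Section Semantics.
Variables (L : signature) (M : structure L) (P : Type).

Lemma eval_fv (e : P -> M) (t : term L P) (v w : var -> M) :
  (forall x, term_fv t x -> v x = w x) -> eval M e v t = eval M e w t.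
Proof.
  induction t as [x|p|f ts IH]; simpl; intros H; auto.
  f_equal. apply functional_extensionality. intros i. apply IH. intros x Hx. apply H. eauto.
Qed.

Lemma sat_fv (e : P -> M) (phi : formula L P) : forall v w : var -> M,
  (forall x, fv phi x -> v x = w x) -> (sat M e v phi <-> sat M e w phi).
Proof.
  induction phi as [t u|r ts|psi IH|p IHp q IHq|x psi IH]; simpl; intros v w H.
  - rewrite (eval_fv e t v w), (eval_fv e u v w) by auto. reflexivity.
  - replace (fun i => eval M e v (ts i)) with (fun i => eval M e w (ts i)); [reflexivity|].
    apply functional_extensionality. intros i. symmetry. apply eval_fv. eauto.
  - rewrite (IH v w H). reflexivity.
  - rewrite (IHp v w), (IHq v w) by auto. reflexivity.
  - assert (K : forall d, sat M e (upd M v x d) psi <-> sat M e (upd M w x d) psi).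
    { intros d. apply IH. intros y Hy. unfold upd. destruct (var_eq_dec y x); auto. }
    split; intros [d Hd]; exists d; apply K; exact Hd.
Qed.

Lemma fin_union_list (n : nat) (T : Type) (l : Fin.t n -> list T) :
  exists l', forall i x, In x (l i) -> In x l'.
Proof.
  induction n as [|n IH].
  - exists []. intros i. inversion i.
  - destruct (IH (fun i => l (Fin.FS i))) as [l' Hl'].
    exists (l Fin.F1 ++ l'). intros i.
    apply (Fin.caseS' i (fun i => forall x, In x (l i) -> In x (l Fin.F1 ++ l')));
      intros; apply in_or_app; eauto.
Qed.

Lemma eval_support (t : term L P) : exists ps, forall (e e' : P -> M) v,
  (forall p, In p ps -> e p = e' p) -> eval M e v t = eval M e' v t.
Proof.
  induction t as [x|p|f ts IH].
  - exists []. reflexivity.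
  - exists [p]. intros e e' v H. apply H. left. reflexivity.
  - destruct (choice _ IH) as [l Hl]. destruct (fin_union_list _ _ l) as [ps Hps].
    exists ps. intros e e' v H. simpl. f_equal. apply functional_extensionality. intros i.
    apply Hl. intros p Hp. apply H. eauto.
Qed.

(** Arities are finite, so a formula mentions finitely many parameters; algebraicity and
    elementarity of maps can thus be tested on finite lists. *)
Lemma sat_support (phi : formula L P) : exists ps, forall (e e' : P -> M) v,
  (forall p, In p ps -> e p = e' p) -> (sat M e v phi <-> sat M e' v phi).
Proof.
  induction phi as [t u|r ts|psi IH|p IHp q IHq|x psi IH].
  - destruct (eval_support t) as [l Hl], (eval_support u) as [l' Hl'].
    exists (l ++ l'). intros e e' v H. simpl.
    rewrite (Hl e e' v), (Hl' e e' v); [reflexivity|..];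
      intros; apply H, in_or_app; auto.
  - destruct (choice _ (fun i => eval_support (ts i))) as [l Hl].
    destruct (fin_union_list _ _ l) as [ps Hps].
    exists ps. intros e e' v H. simpl.
    replace (fun i => eval M e v (ts i)) with (fun i => eval M e' v (ts i)); [reflexivity|].
    apply functional_extensionality. intros i. symmetry. apply Hl. eauto.
  - destruct IH as [ps H]. exists ps. intros e e' v He. simpl. rewrite (H e e' v He). reflexivity.
  - destruct IHp as [l Hl], IHq as [l' Hl'].
    exists (l ++ l'). intros e e' v H. simpl.
    rewrite (Hl e e' v), (Hl' e e' v); [reflexivity|..];
      intros; apply H, in_or_app; auto.
  - destruct IH as [ps H]. exists ps. intros e e' v He. simpl.
    split; intros [d Hd]; exists d; apply (H e e' _ He); exact Hd.
Qed.

Lemma eval_aut (s : M -> M) (e : P -> M) (v : var -> M) (t : term L P) :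
  is_aut M s -> eval M (fun p => s (e p)) (fun x => s (v x)) t = s (eval M e v t).
Proof.
  intros (_ & Hf & _). induction t as [x|p|f ts IH]; simpl; auto.
  rewrite Hf. f_equal. apply functional_extensionality. exact IH.
Qed.

Lemma sat_aut (s : M -> M) (e : P -> M) (phi : formula L P) : is_aut M s ->
  forall v, sat M (fun p => s (e p)) (fun x => s (v x)) phi <-> sat M e v phi.
Proof.
  intros Hs. assert (Ha := Hs). destruct Ha as ([s' [Hs1 Hs2]] & Hf & Hr).
  induction phi as [t u|r ts|psi IH|p IHp q IHq|x psi IH]; intros v; simpl.
  - rewrite !eval_aut by exact Hs. split; [|congruence].
    intros E. rewrite <- (Hs1 (eval M e v t)), E. apply Hs1.
  - rewrite (Hr r (fun i => eval M e v (ts i))).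
    replace (fun i => eval M (fun p => s (e p)) (fun x => s (v x)) (ts i))
      with (fun i => s (eval M e v (ts i))); [reflexivity|].
    apply functional_extensionality. intros i. symmetry. apply eval_aut, Hs.
  - rewrite IH. reflexivity.
  - rewrite IHp, IHq. reflexivity.
  - assert (K : forall d, sat M (fun p => s (e p)) (upd M (fun x => s (v x)) x (s d)) psi
                          <-> sat M e (upd M v x d) psi).
    { intros d. rewrite <- (IH (upd M v x d)).
      replace (upd M (fun x => s (v x)) x (s d)) with (fun y => s (upd M v x d y)); [reflexivity|].
      apply functional_extensionality. intros y. unfold upd. destruct (var_eq_dec y x); reflexivity. }
    split.
    + intros [d Hd]. exists (s' d). apply K. rewrite Hs2. exact Hd.
    + intros [d Hd]. exists (s d). apply K. exact Hd.
Qed.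

End Semantics.

(** * Algebraic closure and automorphisms *)

Section Closure.
Variables (L : signature) (M : structure L).

Lemma aut_id : is_aut M (fun x => x).
Proof.
  split; [exists (fun x => x); auto|]. split; reflexivity.
Qed.

Lemma aut_comp (s t : M -> M) : is_aut M s -> is_aut M t -> is_aut M (fun x => s (t x)).
Proof.
  intros ([s' [S1 S2]] & Sf & Sr) ([t' [T1 T2]] & Tf & Tr). split; [|split].
  - exists (fun x => t' (s' x)). split; intros x.
    + rewrite S1. apply T1.
    + rewrite T2. apply S2.
  - intros f xs. rewrite Tf, Sf. reflexivity.
  - intros r xs. rewrite (Tr r xs), (Sr r). reflexivity.
Qed.

Lemma aut_inverse (s : M -> M) : is_aut M s ->
  exists s', is_aut M s' /\ (forall x, s' (s x) = x) /\ (forall y, s (s' y) = y).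
Proof.
  intros ([s' [S1 S2]] & Sf & Sr). exists s'. split; [|auto]. split; [exists s; auto|].
  assert (K : forall (n : nat) (xs : Fin.t n -> M), (fun i => s (s' (xs i))) = xs).
  { intros n xs. apply functional_extensionality. intros i. apply S2. }
  split.
  - intros f xs. rewrite <- (K _ xs) at 1. rewrite <- Sf. apply S1.
  - intros r xs. rewrite (Sr r (fun i => s' (xs i))), K. reflexivity.
Qed.

(* For small [A] this is [acl A] by saturation and homogeneity, but it needs no formulas. *)
Definition ocl (A : M -> Prop) (x : M) : Prop :=
  exists l, forall s, is_aut M s -> fixes M s A -> In (s x) l.

Lemma subset_ocl A : subset M A (ocl A).
Proof.
  intros x Ax. exists [x]. intros s _ Hs. left. symmetry. apply Hs, Ax.
Qed.

Lemma ocl_mono A B : subset M A B -> subset M (ocl A) (ocl B).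
Proof.
  intros AB x [l Hl]. exists l. intros s Hs HB. apply Hl; [exact Hs|].
  intros y Ay. apply HB, AB, Ay.
Qed.

Lemma ocl_aut (s : M -> M) A x : is_aut M s -> ocl A x -> ocl (image M s A) (s x).
Proof.
  intros Hs [l Hl]. destruct (aut_inverse s Hs) as (s' & Hs' & S1 & S2).
  exists (map s l). intros t Ht Hfix.
  rewrite <- (S2 (t (s x))). apply in_map.
  apply (Hl (fun y => s' (t (s y)))).
  - apply aut_comp; [exact Hs'|]. apply aut_comp; assumption.
  - intros y Ay. rewrite (Hfix (s y)); [apply S1|]. exists y. auto.
Qed.

Lemma image_ocl (s : M -> M) A : is_aut M s -> image M s (ocl A) = ocl (image M s A).
Proof.
  intros Hs. apply predicate_ext. intros y. split.
  - intros (x & Hx & <-). apply ocl_aut; assumption.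
  - intros Hy. destruct (aut_inverse s Hs) as (s' & Hs' & S1 & S2).
    exists (s' y). split; [|apply S2].
    apply (ocl_aut s' _ _ Hs') in Hy. revert Hy. apply ocl_mono.
    intros z (w & (u & Au & <-) & <-). rewrite S1. exact Au.
Qed.

Lemma ocl_tuple_orbit A (ps : list M) : (forall p, In p ps -> ocl A p) ->
  exists T, forall s, is_aut M s -> fixes M s A -> In (map s ps) T.
Proof.
  induction ps as [|p ps IH]; intros H.
  - exists [[]]. intros. left. reflexivity.
  - destruct IH as [T HT]; [intros; apply H; right; assumption|].
    destruct (H p) as [l Hl]; [left; reflexivity|].
    exists (flat_map (fun x => map (cons x) T) l). intros s Hs Hfix.
    apply in_flat_map. exists (s p). split; [auto|]. simpl. apply in_map. auto.
Qed.

(** For each possible image of [ps] fix an automorphism [s0] producing it. Any [s] with the same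
    image differs from [s0] by an automorphism fixing [ps], so [s x] lies in [map s0 l]. *)
Lemma ocl_trans_list A (ps : list M) x :
  (forall p, In p ps -> ocl A p) -> ocl (fun y => In y ps) x -> ocl A x.
Proof.
  intros Hps [l Hl]. destruct (ocl_tuple_orbit A ps Hps) as [T HT].
  assert (K : forall T', exists l', forall s, is_aut M s -> In (map s ps) T' -> In (s x) l').
  { clear T HT. intros T'. induction T' as [|t T' [l' IH]].
    - exists []. contradiction.
    - destruct (classic (exists s0, is_aut M s0 /\ map s0 ps = t)) as [(s0 & Hs0 & E0)|N].
      + exists (map s0 l ++ l'). intros s Hs [E|E]; apply in_or_app; [left|right; auto].
        destruct (aut_inverse s0 Hs0) as (s' & Hs' & S1 & S2).
        rewrite <- (S2 (s x)). apply in_map. apply (Hl (fun y => s' (s y))).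
        * apply aut_comp; assumption.
        * intros y Hy. assert (E1 : s y = s0 y).
          { apply (proj1 (@map_ext_in_iff _ _ s s0 ps)); [congruence|exact Hy]. }
          rewrite E1. apply S1.
      + exists l'. intros s Hs [E|E]; [exfalso; eauto|auto]. }
  destruct (K T) as [l' Hl']. exists l'. auto.
Qed.

(** An automorphism fixing the parameters of an algebraic formula preserves its finite solution
    set. *)
Lemma acl_finite_support A x : acl M A x ->
  exists ps, (forall p, In p ps -> A p) /\ ocl (fun y => In y ps) x.
Proof.
  intros (phi & Hfv & Hx & l & Hl).
  destruct (sat_support _ M _ phi) as [ps Hps].
  exists (map (@proj1_sig _ A) ps). split.
  - intros p Hp. apply in_map_iff in Hp. destruct Hp as (q & <- & _). apply proj2_sig.
  - exists l. intros s Hs Hfix.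
    apply (Hl (fun _ => s x)).
    rewrite (Hps (@proj1_sig _ A) (fun p => s (proj1_sig p))).
    + apply (sat_aut _ M _ s (@proj1_sig _ A) phi Hs (fun _ => x)). auto.
    + intros p Hp. symmetry. apply Hfix. apply in_map, Hp.
Qed.

Lemma subset_acl A : subset M A (acl M A).
Proof.
  intros x Ax. exists (feq (tvar (0, 0)) (tpar (exist _ x Ax))). split; [|split].
  - simpl. intros y [H|[]]. auto.
  - simpl. auto.
  - exists [x]. simpl. auto.
Qed.

(** An algebraic formula over [ocl A] uses finitely many parameters, each with finite orbit over
    [A], so transitivity applies. *)
Lemma closed_ocl A : closed M (ocl A).
Proof.
  intros x. split; [|apply subset_acl].
  intros Hx. destruct (acl_finite_support _ _ Hx) as (ps & Hps & Ho).
  exact (ocl_trans_list A ps x Hps Ho).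
Qed.

Lemma acl_mono A B : subset M A B -> subset M (acl M A) (acl M B).
Proof.
  intros AB x (phi & Hfv & Hx & l & Hl).
  pose (g := fun p : {x | A x} =>
          @inr var {x | B x} (exist B (proj1_sig p) (AB _ (proj2_sig p)))).
  assert (K : forall v, sat M (@proj1_sig _ B) v (tr L _ _ (fun x => x) g phi)
                        <-> sat M (@proj1_sig _ A) v phi).
  { intros v. apply sat_tr; auto.
    - intros p z y E. discriminate E.
    - intros p. reflexivity. }
  exists (tr L _ _ (fun x => x) g phi). split; [|split].
  - intros y Hy. apply tr_fv in Hy. destruct Hy as [(z & Hz & ->)|(p & E)]; [auto|discriminate E].
  - intros v Hv. apply K, Hx, Hv.
  - exists l. intros v Hv. apply Hl, K, Hv.
Qed.

Lemma closed_inter A B : closed M A -> closed M B -> closed M (inter M A B).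
Proof.
  intros HA HB x. split; [|apply subset_acl]. intros Hx. split.
  - apply HA. revert Hx. apply acl_mono. intros y [Hy _]. exact Hy.
  - apply HB. revert Hx. apply acl_mono. intros y [_ Hy]. exact Hy.
Qed.

(** * Small sets and the size of closures *)

Lemma small_subset A B : subset M A B -> small M B -> small M A.
Proof.
  intros AB HB [f Hf]. apply HB.
  exists (fun x => exist B (proj1_sig (f x)) (AB _ (proj2_sig (f x)))).
  intros x y E. inversion E as [E']. apply Hf.
  destruct (f x), (f y). simpl in E'. subst. f_equal. apply proof_irrelevance.
Qed.

Lemma small_image (s : M -> M) A : small M A -> small M (image M s A).
Proof.
  intros HA H. apply HA. apply (embeds_trans _ _ _ H).
  apply (embeds_of_rel _ _ (fun y x => s (proj1_sig x) = proj1_sig y)).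
  - intros (y & x & Ax & E). exists (exist _ x Ax). exact E.
  - intros [y Hy] [y' Hy'] x E E'. simpl in *. subst. f_equal. apply proof_irrelevance.
Qed.

Definition countable (A : M -> Prop) : Prop :=
  exists f : M -> nat, forall x y, A x -> A y -> f x = f y -> x = y.

Lemma countable_union A B : countable A -> countable B -> countable (union M A B).
Proof.
  intros [f Hf] [g Hg].
  exists (fun x => if excluded_middle_informative (A x) then 2 * f x else 2 * g x + 1).
  intros x y Hx Hy.
  destruct (excluded_middle_informative (A x)), (excluded_middle_informative (A y)); intros E;
    try lia.
  - apply Hf; auto; lia.
  - destruct Hx, Hy; try contradiction. apply Hg; auto; lia.
Qed.

Lemma countable_range (a : nat -> M) : countable (fun x => exists n, a n = x).
Proof.
  exists (fun x => epsilon (inhabits 0) (fun n => a n = x)).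
  intros x y Hx Hy E.
  rewrite <- (epsilon_spec (inhabits 0) _ Hx), <- (epsilon_spec (inhabits 0) _ Hy).
  rewrite E. reflexivity.
Qed.

Lemma countable_subset A B : subset M A B -> countable B -> countable A.
Proof.
  intros AB [f Hf]. exists f. auto.
Qed.

Lemma countable_list (l : list M) : countable (fun x => In x l).
Proof.
  destruct l as [|x0 l0]; [exists (fun _ => 0); contradiction|].
  apply (countable_subset _ _ (fun x H => let (n, Hn) := In_nth _ _ x0 H in
            ex_intro _ n (proj2 Hn))).
  apply countable_range.
Qed.

Lemma small_countable A : small_type M nat -> countable A -> small M A.
Proof.
  intros Hnat [f Hf] H. apply Hnat. apply (embeds_trans _ _ _ H).
  exists (fun p => f (proj1_sig p)). intros [x Hx] [y Hy] E. simpl in E.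
  apply Hf in E; auto. subst. f_equal. apply proof_irrelevance.
Qed.

(* Otherwise every formula over [A] true of [x] has a solution outside the finite orbit, and a
   realization of [tp(x/A)] outside it would be a conjugate of [x]. *)
Lemma ocl_subset_acl A : saturated M -> strongly_homogeneous M -> small_type M nat ->
  countable A -> subset M (ocl A) (acl M A).
Proof.
  intros Hsat Hhom Hnat HA x [l Hl]. apply NNPP. intros N.
  assert (xA : ~ A x) by (intros H; apply N, subset_acl, H).
  assert (Hinf : forall psi : formula L {x | A x}, (forall y, fv psi y -> y = (0, 0)) ->
     sat M (@proj1_sig _ A) (fun _ => x) psi ->
     exists v, sat M (@proj1_sig _ A) v psi /\ ~ In (v (0, 0)) l).
  { intros psi Hfv Hx. apply NNPP. intros H. apply N. exists psi. split; [exact Hfv|]. split.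
    - intros v Hv. apply (sat_fv _ M _ _ psi v (fun _ => x)); [|exact Hx].
      intros y Hy. rewrite (Hfv y Hy). exact Hv.
    - exists l. intros v Hv. apply NNPP. eauto. }
  pose (B := union M A (fun y => In y l)).
  assert (sB : small M B).
  { apply small_countable; [exact Hnat|].
    apply countable_union; [exact HA|apply countable_list]. }
  pose (g := fun p : {x | A x} => @inr var {x | B x} (exist B (proj1_sig p) (or_introl (proj2_sig p)))).
  assert (K : forall phi v, sat M (@proj1_sig _ B) v (tr L _ _ (fun x => x) g phi)
                        <-> sat M (@proj1_sig _ A) v phi).
  { intros phi v. apply sat_tr; auto.
    - intros p z y E. discriminate E.
    - intros p. reflexivity. }
  (* The type of [x] over [A], with the demand to avoid [l]; the members of [l] occur as parameters,
     hence the larger set [B]. *)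
  pose (Sigma := fun phi : formula L {x | B x} =>
     (exists psi, (forall y, fv psi y -> y = (0, 0)) /\
        sat M (@proj1_sig _ A) (fun _ => x) psi /\ phi = tr L _ _ (fun x => x) g psi) \/
     (exists p, In (proj1_sig p) l /\ phi = fnot (feq (tvar (0, 0)) (tpar p)))).
  destruct (Hsat B sB Sigma) as [v Hv].
  - intros phi [(psi & Hfv & _ & ->)|(p & _ & ->)] y Hy.
    + apply tr_fv in Hy. destruct Hy as [(z & Hz & ->)|(q & E)]; [auto|discriminate E].
    + destruct Hy as [E|[]]; auto.
  - intros lf Hlf.
    (* The members of [lf] coming from the type are conjoined into a single [psi], to which [Hinf]
       applies. *)
    assert (C : exists psi, (forall y, fv psi y -> y = (0, 0)) /\
        sat M (@proj1_sig _ A) (fun _ => x) psi /\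
        forall v, sat M (@proj1_sig _ A) v psi -> ~ In (v (0, 0)) l ->
          forall phi, In phi lf -> sat M (@proj1_sig _ B) v phi).
    { induction lf as [|phi lf IH].
      - exists (feq (tvar (0, 0)) (tvar (0, 0))). simpl. split; [|split].
        + intros y [H|H]; auto.
        + reflexivity.
        + contradiction.
      - destruct IH as (psi & Hfv & Hx & Himp); [intros; apply Hlf; right; assumption|].
        destruct (Hlf phi (or_introl eq_refl)) as [(chi & Hfv' & Hx' & ->)|(p & Hp & ->)].
        + exists (fand psi chi). simpl. split; [|split].
          * intros y [H|H]; auto.
          * auto.
          * intros v [H1 H2] Hl' phi [<-|H]; [apply K; exact H2|auto].
        + exists psi. split; [exact Hfv|]. split; [exact Hx|].
          intros v H1 Hl' phi [<-|H]; [|auto].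
          simpl. intros E. apply Hl'. rewrite E. exact Hp. }
    destruct C as (psi & Hfv & Hx & Himp).
    destruct (Hinf psi Hfv Hx) as (v & H1 & H2). exists v. auto.
  - assert (yl : ~ In (v (0, 0)) l).
    { intros H. refine (Hv (fnot (feq (tvar (0, 0)) (tpar (exist B _ (or_intror H))))) _ eq_refl).
      right. eexists. split; [|reflexivity]. exact H. }
    set (y := v (0, 0)) in *.
    pose (A' := union M A (fun z => In z [x])).
    assert (sA' : small M A').
    { apply small_countable; [exact Hnat|].
      apply countable_union; [exact HA|apply countable_list]. }
    assert (inA : forall p : {z | A' z}, proj1_sig p <> x -> A (proj1_sig p)).
    { intros [z [Hz|[E|[]]]] Nz; simpl in *; [exact Hz|congruence]. }
    pose (h := fun p : {z | A' z} =>
       if excluded_middle_informative (proj1_sig p = x) then y else proj1_sig p).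
    pose (gg := fun p : {z | A' z} => match excluded_middle_informative (proj1_sig p = x) with
       | left _ => @inl var {z | A z} (0, 0)
       | right Nz => inr (exist A (proj1_sig p) (inA p Nz)) end).
    (* Variables are shifted so that no quantifier captures [(0, 0)], which replaces [x]. *)
    pose (rho := fun z : var => (fst z, S (snd z))).
    assert (rinj : forall z w, rho z = rho w -> z = w).
    { intros [z1 z2] [w1 w2] E. inversion E. reflexivity. }
    assert (rfresh : forall p z w, gg p = inl z -> rho w <> z).
    { intros p z w. unfold gg. destruct (excluded_middle_informative (proj1_sig p = x)); intros E.
      - inversion E. discriminate.
      - discriminate E. }
    (* With [x] turned into the variable [(0, 0)], the sentence becomes a formula of the type of
       [x], so it holds of [y]. Applied to negations this also gives the converse. *)
    assert (half : forall phi : formula L {z | A' z}, sentence phi ->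
       forall u, sat M (@proj1_sig _ A') u phi -> sat M h u phi).
    { intros phi Hphi u Hu.
      assert (Hpsi : sat M (@proj1_sig _ A) v (tr L _ _ rho gg phi)).
      { apply K, Hv. left. eexists. split; [|split; [|reflexivity]].
        - intros z Hz. apply tr_fv in Hz. destruct Hz as [(w & Hw & _)|(p & E)].
          + exfalso. exact (Hphi _ Hw).
          + revert E. unfold gg.
            destruct (excluded_middle_informative (proj1_sig p = x)); intros E;
              [inversion E; reflexivity|discriminate E].
        - apply (sat_tr L _ _ rho gg M (@proj1_sig _ A') (@proj1_sig _ A) rinj rfresh phi (fun _ => x)).
          + intros p. unfold gg. destruct (excluded_middle_informative (proj1_sig p = x)); auto.
          + reflexivity.
          + apply (sat_fv _ M _ _ phi u); [|exact Hu].
            intros z Hz. exfalso. exact (Hphi _ Hz). }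
      apply (sat_tr L _ _ rho gg M h (@proj1_sig _ A) rinj rfresh phi (fun z => v (rho z))) in Hpsi.
      - revert Hpsi. apply sat_fv. intros z Hz. exfalso. exact (Hphi _ Hz).
      - intros p. unfold gg, h. destruct (excluded_middle_informative (proj1_sig p = x)); auto.
      - reflexivity. }
    destruct (Hhom A' sA' h) as (s & Hs & Hsh).
    { intros phi Hphi u. split; [apply half; exact Hphi|].
      intros H. apply NNPP. intros N'. exact (half (fnot phi) Hphi u N' H). }
    apply yl.
    assert (E : s x = y).
    { assert (E := Hsh (exist A' x (or_intror (or_introl eq_refl)))).
      unfold h in E. simpl in E. rewrite E.
      destruct (excluded_middle_informative (x = x)); congruence. }
    rewrite <- E. apply Hl; [exact Hs|].
    intros z Az. assert (Ez := Hsh (exist A' z (or_introl Az))).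
    unfold h in Ez. simpl in Ez. rewrite Ez.
    destruct (excluded_middle_informative (z = x)); [subst; contradiction|reflexivity].
Qed.

(** The largest of the three cardinals serves as [Y]; comparability replaces cardinal addition. *)
Lemma small_language_bound :
  small_type M nat -> small_type M (funs L) -> small_type M (rels L) ->
  exists Y : Type, ~ embeds M Y /\ embeds nat Y /\ embeds (funs L) Y /\ embeds (rels L) Y.
Proof.
  intros Hn Hf Hr.
  assert (refl : forall X, embeds X X) by (intros X; exists (fun x => x); auto).
  destruct (embeds_total nat (funs L)) as [H1|H1].
  - destruct (embeds_total (funs L) (rels L)) as [H2|H2].
    + exists (rels L). repeat split; auto. exact (embeds_trans _ _ _ H1 H2).
    + exists (funs L). auto.
  - destruct (embeds_total nat (rels L)) as [H2|H2].
    + exists (rels L). repeat split; auto. exact (embeds_trans _ _ _ H1 H2).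
    + exists nat. auto.
Qed.

(** An algebraic element is coded by a formula over [A] and a place in a list of its solutions.
    These codes fit into some [Y] into which [M] does not embed. *)
Lemma small_ocl A : monster M -> countable A -> small M (ocl A).
Proof.
  intros (Hn & Hf & Hr & Hsat & Hhom) HA.
  apply (small_subset _ (acl M A)).
  { apply ocl_subset_acl; assumption. }
  destruct (small_language_bound Hn Hf Hr) as (Y & HY & Yn & Yf & Yr).
  assert (Ysq := embeds_square Y Yn).
  assert (YP : embeds {x | A x} Y).
  { destruct HA as [f Hfi]. refine (embeds_trans _ _ _ _ Yn).
    exists (fun p => f (proj1_sig p)). intros [x Hx] [y Hy] E. simpl in E.
    apply Hfi in E; auto. subst. f_equal. apply proof_irrelevance. }
  destruct (embeds_formula L {x | A x} Y Yn Ysq Yf Yr YP) as [enc Henc].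
  destruct Ysq as [pair Hpair]. destruct Yn as [num Hnum].
  (* One list per formula; if no list contains all solutions, the default is [[]]. *)
  assert (C : exists sols : formula L {x | A x} -> list M, forall phi,
     (exists l : list M, forall v, sat M (@proj1_sig _ A) v phi -> In (v (0, 0)) l) ->
     forall v, sat M (@proj1_sig _ A) v phi -> In (v (0, 0)) (sols phi)).
  { apply choice with (R := fun phi l' =>
     (exists l : list M, forall v, sat M (@proj1_sig _ A) v phi -> In (v (0, 0)) l) ->
     forall v, sat M (@proj1_sig _ A) v phi -> In (v (0, 0)) l').
    intros phi.
    destruct (classic (exists l : list M, forall v, sat M (@proj1_sig _ A) v phi -> In (v (0, 0)) l))
      as [[l Hl]|N]; [exists l; auto|exists []; contradiction]. }
  destruct C as [sols Hsols].
  intros H. apply HY. apply (embeds_trans _ _ _ H).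
  (* An element may have several codes, but a code determines its element. *)
  apply (embeds_of_rel _ _ (fun x z => exists phi i,
     nth_error (sols phi) i = Some (proj1_sig x) /\ z = pair (enc phi, num i))).
  - intros [x Hacl]. assert (H0 := Hacl). destruct H0 as (phi & _ & Hx & Hl).
    destruct (In_nth_error (sols phi) x) as [i Hi].
    { exact (Hsols phi Hl (fun _ => x) (Hx (fun _ => x) eq_refl)). }
    exists (pair (enc phi, num i)), phi, i. auto.
  - intros [x Hx] [x' Hx'] z (phi & i & E & Ez) (phi' & i' & E' & Ez'). simpl in *.
    subst z. apply Hpair in Ez'. inversion Ez' as [[E1 E2]].
    apply Henc in E1. apply Hnum in E2. subst.
    assert (x = x') by congruence. subst. f_equal. apply proof_irrelevance.
Qed.

(** A sentence over [A] involves finitely many parameters, on which [g] agrees with an automorphism,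
    so [g] is elementary on [A]. *)
Lemma homogeneous_extension A (g : M -> M) : strongly_homogeneous M -> small M A ->
  (forall ps, (forall p, In p ps -> A p) ->
     exists s, is_aut M s /\ forall p, In p ps -> s p = g p) ->
  exists s, is_aut M s /\ forall x, A x -> s x = g x.
Proof.
  intros Hhom sA Hg.
  destruct (Hhom A sA (fun p => g (proj1_sig p))) as (s & Hs & E).
  - intros phi Hphi v. destruct (sat_support _ M _ phi) as [ps Hps].
    destruct (Hg (map (@proj1_sig _ A) ps)) as (s & Hs & E).
    { intros p Hp. apply in_map_iff in Hp. destruct Hp as (q & <- & _). apply proj2_sig. }
    rewrite <- (sat_aut _ M _ s (@proj1_sig _ A) phi Hs v).
    rewrite (Hps (fun p => s (proj1_sig p)) (fun p => g (proj1_sig p))).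
    + apply sat_fv. intros x Hx. exfalso. exact (Hphi x Hx).
    + intros p Hp. apply E, in_map, Hp.
  - exists s. split; [exact Hs|]. intros x Ax. exact (E (exist _ x Ax)).
Qed.

End Closure.

(** * Indiscernible sequences *)

Lemma pigeonhole T (l : list T) (f : nat -> T) : (forall i, i <= length l -> In (f i) l) ->
  exists i j, i < j <= length l /\ f i = f j.
Proof.
  intros H. apply NNPP. intros N.
  assert (Hinj : NoDup (map f (seq 0 (S (length l))))).
  { apply NoDup_map_NoDup_ForallPairs; [|apply seq_NoDup].
    intros i j Hi Hj E. apply in_seq in Hi, Hj.
    destruct (Nat.lt_trichotomy i j) as [K|[K|K]]; [|exact K|]; exfalso; apply N.
    - exists i, j. split; [lia|exact E].
    - exists j, i. split; [lia|congruence]. }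
  apply NoDup_incl_length with (l' := l) in Hinj.
  - rewrite length_map, length_seq in Hinj. lia.
  - intros x Hx. apply in_map_iff in Hx. destruct Hx as (i & <- & Hi).
    apply in_seq in Hi. apply H. lia.
Qed.

(** Listing subsets as predicates, equal by extensionality, lets [pigeonhole] return two equal sets
    of copies. *)
Lemma subsets_of_list T (l : list T) :
  exists P : list (T -> Prop), forall F : T -> Prop, (forall x, F x -> In x l) -> In F P.
Proof.
  induction l as [|x l [P IH]].
  - exists [fun _ => False]. intros F HF. left. apply predicate_ext. intros y.
    split; [contradiction|apply HF].
  - exists (P ++ map (fun F y => y = x \/ F y) P). intros F HF.
    pose (F' := fun y => F y /\ y <> x).
    assert (K : In F' P).
    { apply IH. intros y [Fy N]. destruct (HF y Fy); [congruence|assumption]. }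
    apply in_or_app. destruct (classic (F x)) as [Fx|N].
    + right. apply in_map_iff. exists F'. split; [|exact K].
      apply predicate_ext. intros y. unfold F'.
      destruct (classic (y = x)) as [->|]; tauto.
    + left. replace F with F'; [exact K|]. apply predicate_ext. intros y. unfold F'.
      split; [tauto|]. intros Fy. split; [exact Fy|]. intros ->. contradiction.
Qed.

Section Indiscernible.
Variables (L : signature) (M : structure L) (k : nat) (a : nat -> nat -> M).
Hypothesis (Hmon : monster M) (Hind : indiscernible M k a).

Definition carries (s : M -> M) (i i' : nat) : Prop := forall j, j < k -> s (a i j) = a i' j.

Definition entries (i : nat) (x : M) : Prop := exists j, j < k /\ a i j = x.

Lemma carries_inverse s s' i i' :
  (forall x, s' (s x) = x) -> carries s i i' -> carries s' i' i.
Proof.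
  intros S1 H j Hj. rewrite <- (H j Hj). apply S1.
Qed.

Lemma carries_comp s t i j l : carries s i j -> carries t j l -> carries (fun x => t (s x)) i l.
Proof.
  intros H H' n Hn. rewrite (H n Hn). auto.
Qed.

Lemma image_entries s i i' : carries s i i' -> image M s (entries i) = entries i'.
Proof.
  intros H. apply predicate_ext. intros x. split.
  - intros (y & (j & Hj & <-) & <-). exists j. split; [exact Hj|]. symmetry. auto.
  - intros (j & Hj & <-). exists (a i j). split; [exists j; auto|auto].
Qed.

Lemma countable_entries i : countable L M (entries i).
Proof.
  apply (countable_subset _ _ _ (fun x => exists n, a i n = x)); [|apply countable_range].
  intros x (j & _ & E). eauto.
Qed.

(** Naming each entry by a position turns sentences over the entries into formulas about the
    sequence. Indiscernibility makes the map between the subsequences elementary, and homogeneity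
    extends it. *)
Lemma indiscernible_aut (s t : nat -> nat) : strictly_increasing s -> strictly_increasing t ->
  exists u, is_aut M u /\ forall i, carries u (s i) (t i).
Proof.
  intros Hs Ht.
  pose (A := fun x => exists i j, j < k /\ a (s i) j = x).
  assert (sA : small M A).
  { apply small_countable; [apply Hmon|].
    apply (countable_subset _ _ _ (fun x => exists n,
        (let p := Cantor.of_nat n in a (s (fst p)) (snd p)) = x)); [|apply countable_range].
    intros x (i & j & _ & E). exists (Cantor.to_nat (i, j)). rewrite Cantor.cancel_of_to. exact E. }
  destruct (choice (fun (p : {x | A x}) q => snd q < k /\ a (s (fst q)) (snd q) = proj1_sig p))
    as [pos Hpos].
  { intros (x & i & j & Hj & E). exists (i, j). auto. }
  pose (g := fun p : {x | A x} => @inl var Empty_set (pos p)).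
  (* Parameters become variables with second index below [k]; shifting by [k] avoids capture. *)
  pose (rho := fun z : var => (fst z, snd z + k)).
  assert (rinj : forall x y, rho x = rho y -> x = y).
  { intros [x1 x2] [y1 y2] E. inversion E. f_equal; lia. }
  assert (rfresh : forall p z x, g p = inl z -> rho x <> z).
  { intros p z x E E'. destruct (Hpos p) as [H _].
    injection E as E. rewrite E, <- E' in H. simpl in H. lia. }
  assert (T : forall e r, (forall p, e p = a (r (fst (pos p))) (snd (pos p))) ->
     forall phi : formula L {x | A x}, sentence phi -> forall v,
     sat M e v phi <-> sat M (noparam M) (tuple_val M k a r) (tr L _ _ rho g phi)).
  { intros e r He phi Hphi v.
    rewrite (sat_tr L _ _ rho g M e (noparam M) rinj rfresh phi
              (fun x => tuple_val M k a r (rho x)) (tuple_val M k a r)).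
    - apply sat_fv. intros x Hx. exfalso. exact (Hphi x Hx).
    - intros p. apply He.
    - reflexivity. }
  destruct Hmon as (_ & _ & _ & _ & Hhom).
  destruct (Hhom A sA (fun p => a (t (fst (pos p))) (snd (pos p)))) as (u & Hu & Eu).
  { intros phi Hphi v.
    rewrite (T (@proj1_sig _ A) s), (T _ t); auto.
    - apply Hind; [exact Hs|exact Ht|].
      intros x Hx. apply tr_fv in Hx. destruct Hx as [(z & Hz & _)|(p & E)].
      + exfalso. exact (Hphi z Hz).
      + inversion E. apply Hpos.
    - intros p. symmetry. apply Hpos. }
  exists u. split; [exact Hu|]. intros i j Hj.
  assert (Ax : A (a (s i) j)) by (exists i, j; auto).
  assert (Ea := Eu (exist A _ Ax)). simpl in Ea. rewrite Ea.
  (* Entries may coincide, so the chosen position [(i', j')] can differ from [(i, j)]; the equation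
     between the two entries is a formula and transfers. *)
  destruct (pos (exist A _ Ax)) as [i' j'] eqn:E. simpl.
  destruct (Hpos (exist A _ Ax)) as [Hj' E']. rewrite E in Hj', E'. simpl in Hj', E'.
  apply (Hind s t Hs Ht (feq (tvar (i', j')) (tvar (i, j)))).
  - simpl. intros x [<-|<-]; assumption.
  - exact E'.
Qed.

Lemma indiscernible_triple i j n i' j' n' : i < j < n -> i' < j' < n' ->
  exists u, is_aut M u /\ carries u i i' /\ carries u j j' /\ carries u n n'.
Proof.
  intros H H'.
  (* The triple is continued by consecutive indices; position 2 has value [n + 0]. *)
  pose (s := fun i j n m => match m with 0 => i | 1 => j | S (S m) => n + m end).
  assert (Hs : forall i j n, i < j < n -> strictly_increasing (s i j n)).
  { intros p q r K m m' Hm. destruct m as [|[|m]], m' as [|[|m']]; simpl; lia. }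
  destruct (indiscernible_aut _ _ (Hs i j n H) (Hs i' j' n' H')) as (u & Hu & C).
  exists u. split; [exact Hu|]. split; [exact (C 0)|]. split; [exact (C 1)|].
  specialize (C 2). simpl in C. rewrite !Nat.add_0_r in C. exact C.
Qed.

(** * Copies of tuples and the shift automorphism *)

Notation E i := (ocl L M (entries i)).

Lemma image_ocl_entries s i i' : is_aut M s -> carries s i i' -> image M s (E i) = E i'.
Proof.
  intros Hs C. rewrite image_ocl by exact Hs. rewrite (image_entries s i i' C). reflexivity.
Qed.

(** The orbit of [ds] over [(a 0, a 1)], transported to [(a i, a j)]. *)
Definition copies (ds : list M) (i j : nat) (xs : list M) : Prop :=
  exists s, is_aut M s /\ carries s 0 i /\ carries s 1 j /\ xs = map s ds.

Lemma copies_aut ds s i j i' j' xs : is_aut M s -> carries s i i' -> carries s j j' ->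
  copies ds i j xs -> copies ds i' j' (map s xs).
Proof.
  intros Hs Ci Cj (t & Ht & C0 & C1 & ->).
  exists (fun x => s (t x)). split; [apply aut_comp; assumption|].
  split; [apply (carries_comp t s 0 i i'); assumption|].
  split; [apply (carries_comp t s 1 j j'); assumption|]. apply map_map.
Qed.

Lemma map_cancel (s s' : M -> M) xs : (forall x, s (s' x) = x) -> map s (map s' xs) = xs.
Proof.
  intros H. rewrite map_map. rewrite (map_ext _ (fun x => x) H). apply map_id.
Qed.

Lemma copies_eq_transfer ds s i j i' j' p q p' q' : is_aut M s ->
  carries s i p -> carries s j q -> carries s i' p' -> carries s j' q' ->
  (forall xs, copies ds i j xs <-> copies ds i' j' xs) ->
  forall xs, copies ds p q xs <-> copies ds p' q' xs.
Proof.
  intros Hs C1 C2 C3 C4 H xs.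
  destruct (aut_inverse _ _ s Hs) as (s' & Hs' & S1 & S2).
  split; intros X; rewrite <- (map_cancel s s' xs S2).
  - apply (copies_aut ds s i' j'); auto. apply H.
    apply (copies_aut ds s' p q); auto; eapply carries_inverse; eauto.
  - apply (copies_aut ds s i j); auto. apply H.
    apply (copies_aut ds s' p' q'); auto; eapply carries_inverse; eauto.
Qed.

Lemma carries_fixes s i : carries s i i -> fixes M s (entries i).
Proof.
  intros C x (j & Hj & <-). auto.
Qed.

(* The copies of [ds] over [a 0, a (S j)] lie in one finite set, so two of these sets agree
   for different [j]; by indiscernibility all of them do. *)
Lemma copies_right ds : (forall d, In d ds -> E 0 d) ->
  forall xs, copies ds 0 1 xs <-> copies ds 0 2 xs.
Proof.
  intros H0. destruct (ocl_tuple_orbit _ _ _ ds H0) as [T HT].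
  destruct (subsets_of_list _ T) as [P HP].
  destruct (pigeonhole _ P (fun j => copies ds 0 (S j))) as (i & j & Hij & Eq).
  { intros i _. apply HP. intros xs (s & Hs & C0 & _ & ->).
    apply HT; [exact Hs|]. apply carries_fixes, C0. }
  destruct (indiscernible_triple 0 (S i) (S j) 0 1 2) as (u & Hu & C0 & C1 & C2); [lia|lia|].
  apply (copies_eq_transfer ds u 0 (S i) 0 (S j)); auto.
  intros xs. rewrite Eq. reflexivity.
Qed.

(* As on the right, except that the finite set depends on the last index [n], which has to be
   fixed beyond the pigeonhole bound; hence everything is pulled back to index [1]. *)
Lemma copies_left ds : (forall d, In d ds -> E 1 d) ->
  forall xs, copies ds 0 2 xs <-> copies ds 1 2 xs.
Proof.
  intros H1. destruct (ocl_tuple_orbit _ _ _ ds H1) as [T HT].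
  destruct (subsets_of_list _ T) as [P HP].
  (* [n] exceeds every index that [pigeonhole] can return, all of them at most [length P]. *)
  pose (n := S (S (length P))).
  destruct (indiscernible_triple 0 1 2 0 n (S n)) as (t & Ht & _ & Cn & _); [lia|unfold n; lia|].
  destruct (aut_inverse _ _ t Ht) as (t' & Ht' & T1 & T2).
  destruct (pigeonhole _ P (fun i xs => copies ds i n (map t xs))) as (i & j & Hij & Eq).
  { intros i _. apply HP. intros xs (s & Hs & _ & C1 & Exs).
    replace xs with (map (fun x => t' (s x)) ds).
    - apply HT; [apply aut_comp; assumption|]. apply carries_fixes.
      apply (carries_comp s t' 1 n 1); [exact C1|]. exact (carries_inverse t t' 1 n T1 Cn).
    - rewrite <- (map_cancel t' t xs T1), Exs. symmetry. apply map_map. }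
  destruct (indiscernible_triple i j n 0 1 2) as (u & Hu & C0 & C1 & C2); [unfold n; lia|lia|].
  apply (copies_eq_transfer ds u i n j n); auto.
  intros xs. rewrite <- (map_cancel t t' xs T2).
  exact (eq_ind_r (fun F : list M -> Prop => F (map t' xs) <-> copies ds j n (map t (map t' xs)))
           (iff_refl _) Eq).
Qed.

(** [ds] is a copy of itself over [(a 0, a 1)], hence over [(a 0, a 2)] and then over [(a 1, a 2)];
    the automorphism witnessing the last is the shift. *)
Lemma shift_fixing_list ds : (forall d, In d ds -> E 0 d /\ E 1 d) ->
  exists s, is_aut M s /\ carries s 0 1 /\ carries s 1 2 /\ forall d, In d ds -> s d = d.
Proof.
  intros H.
  assert (X : copies ds 0 1 ds).
  { exists (fun x => x). split; [apply aut_id|]. split; [intros j _; reflexivity|].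
    split; [intros j _; reflexivity|]. symmetry. apply map_id. }
  apply copies_right in X; [|intros; apply H; assumption].
  apply copies_left in X; [|intros; apply H; assumption].
  destruct X as (s & Hs & C0 & C1 & Eds). exists s. do 3 (split; [assumption|]).
  intros d Hd. rewrite <- map_id in Eds at 1.
  symmetry. apply (proj1 (@map_ext_in_iff _ _ (fun x => x) s ds) Eds d Hd).
Qed.

(** [shift_fixing_list] treats finite parts of the intersection; homogeneity assembles them, the
    intersection and the two tuples forming a small set. *)
Lemma shift_fixing_intersection :
  exists s, is_aut M s /\ fixes M s (inter M (E 0) (E 1)) /\ carries s 0 1 /\ carries s 1 2.
Proof.
  set (D := inter M (E 0) (E 1)).
  pose (A := union M D (union M (entries 0) (entries 1))).
  pose (idx := fun i x => epsilon (inhabits 0) (fun j => j < k /\ a i j = x)).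
  assert (Hidx : forall i x, entries i x -> idx i x < k /\ a i (idx i x) = x).
  { intros i x Hx. exact (epsilon_spec (inhabits 0) _ Hx). }
  (* The cases may overlap, but on each finite list of points of [A] the map [g] agrees with a shift
     fixing the members in [D]. *)
  pose (g := fun x => if excluded_middle_informative (D x) then x else
                      if excluded_middle_informative (entries 0 x) then a 1 (idx 0 x)
                      else a 2 (idx 1 x)).
  assert (G : forall ps, (forall p, In p ps -> A p) -> exists s, is_aut M s /\
     carries s 0 1 /\ carries s 1 2 /\ forall p, In p ps -> s p = g p).
  { intros ps Hps.
    pose (inD := fun x => if excluded_middle_informative (D x) then true else false).
    destruct (shift_fixing_list (filter inD ps)) as (s & Hs & C0 & C1 & Hfix).
    { intros d Hd. apply filter_In in Hd. destruct Hd as [_ Hd]. unfold inD in Hd.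
      destruct (excluded_middle_informative (D d)); [assumption|discriminate]. }
    exists s. do 3 (split; [assumption|]). intros p Hp. unfold g.
    destruct (excluded_middle_informative (D p)) as [Dp|ND].
    - apply Hfix, filter_In. split; [exact Hp|]. unfold inD.
      destruct (excluded_middle_informative (D p)); [reflexivity|contradiction].
    - destruct (excluded_middle_informative (entries 0 p)) as [E0|N0].
      + destruct (Hidx 0 p E0) as [Hj Ep]. rewrite <- Ep at 1. apply C0, Hj.
      + destruct (Hps p Hp) as [Dp|[E0|E1]]; try contradiction.
        destruct (Hidx 1 p E1) as [Hj Ep]. rewrite <- Ep at 1. apply C1, Hj. }
  destruct (homogeneous_extension _ M A g) as (s & Hs & Hsg).
  - apply Hmon.
  - apply (small_subset _ _ _ (ocl L M (union M (entries 0) (entries 1)))).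
    + intros x [[Dx _]|Hx].
      * revert Dx. apply ocl_mono. intros y Hy. left. exact Hy.
      * apply subset_ocl. exact Hx.
    + apply small_ocl; [exact Hmon|]. apply countable_union; apply countable_entries.
  - intros ps Hps. destruct (G ps Hps) as (s & Hs & _ & _ & Es). eauto.
  - exists s. split; [exact Hs|]. split; [|split].
    + intros x Dx. rewrite (Hsg x (or_introl Dx)). unfold g.
      destruct (excluded_middle_informative (D x)); [reflexivity|contradiction].
    (* [a 0 j] may lie in [D], where [g] is the identity; its value is therefore read off a shift
       given by [G]. *)
    + intros j Hj. assert (Ax : A (a 0 j)) by (right; left; exists j; auto).
      destruct (G [a 0 j]) as (t & _ & C0 & _ & Et); [intros p [<-|[]]; exact Ax|].
      rewrite (Hsg _ Ax), <- (Et (a 0 j)) by (left; reflexivity). auto.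
    + intros j Hj. assert (Ax : A (a 1 j)) by (right; right; exists j; auto).
      destruct (G [a 1 j]) as (t & _ & _ & C1 & Et); [intros p [<-|[]]; exact Ax|].
      rewrite (Hsg _ Ax), <- (Et (a 1 j)) by (left; reflexivity). auto.
Qed.

End Indiscernible.

(** * Free amalgamation *)

(** Full existence and stationarity speak of tuples; a set becomes a tuple indexed by its own
    elements. *)
Lemma range_restrict (L : signature) (M : structure L) (s : M -> M) (A : M -> Prop) :
  range M (fun p : {x | A x} => s (proj1_sig p)) = image M s A.
Proof.
  apply predicate_ext. intros y. split.
  - intros [[x Ax] <-]. exists x. auto.
  - intros (x & Ax & <-). exists (exist _ x Ax). reflexivity.
Qed.

Lemma image_id (L : signature) (M : structure L) (A : M -> Prop) :
  image M (fun x => x) A = A.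
Proof.
  apply predicate_ext. intros y. split; [intros (x & Ax & <-); exact Ax|exists y; auto].
Qed.

Lemma image_fixed (L : signature) (M : structure L) (s : M -> M) (A : M -> Prop) :
  fixes M s A -> image M s A = A.
Proof.
  intros H. apply predicate_ext. intros y. split.
  - intros (x & Ax & <-). rewrite (H x Ax). exact Ax.
  - intros Ay. exists y. auto.
Qed.

(* With [b = s a] and [b' = s b], both [a] and [b'] are free from [b] over [D], so stationarity
   gives [a b == b' b] over [D]; composing with [s] turns this into [a b == b a]. *)
Lemma free_swap (L : signature) (M : structure L) ind (s : M -> M) (V D : M -> Prop) :
  free_amalgamation_relation M ind -> is_aut M s -> fixes M s D ->
  small M (ocl L M V) -> closed M D -> subset M D (ocl L M V) ->
  ind (image M s (ocl L M V)) D (ocl L M V) ->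
  exists t, is_aut M t /\ forall x, ocl L M V x -> t x = s x /\ t (s x) = x.
Proof.
  intros (Finv & _ & Fsym & _ & _ & Fstat & _) Hs HD sA cD DA Hind.
  set (A := ocl L M V) in *.
  assert (sI : forall u, small M (image M u A)) by (intros; apply small_image, sA).
  assert (sD : small M D) by exact (small_subset _ _ _ _ DA sA).
  assert (Hss : is_aut M (fun x => s (s x))) by (apply aut_comp; assumption).
  assert (cI : forall u, is_aut M u -> closed M (image M u A)).
  { intros u Hu. unfold A. rewrite image_ocl by exact Hu. apply closed_ocl. }
  assert (DsA : subset M D (image M s A)).
  { intros x Dx. exists x. auto. }
  assert (Eii : image M s (image M s A) = image M (fun x => s (s x)) A).
  { apply predicate_ext. intros y. split.
    - intros (x & (z & Az & <-) & <-). exists z. auto.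
    - intros (z & Az & <-). exists (s z). split; [exists z; auto|reflexivity]. }
  assert (HsD : image M s D = D) by (apply image_fixed, HD).
  assert (Free0 : ind A D (image M s A)) by (apply Fsym; auto).
  assert (Free1 : ind (image M (fun x => s (s x)) A) D (image M s A)).
  { rewrite <- Eii, <- HsD at 1. apply Finv; auto. }
  pose (P := {x | A x}).
  assert (R0 : range M (fun p : P => proj1_sig p) = A).
  { exact (eq_trans (range_restrict L M (fun x => x) A) (image_id L M A)). }
  assert (R1 := range_restrict L M s A).
  assert (R2 := range_restrict L M (fun x => s (s x)) A).
  assert (Stat : equiv_over M D (I := P + P)
     (fun q => match q with inl i => proj1_sig i | inr j => s (proj1_sig j) end)
     (fun q => match q with inl i => s (s (proj1_sig i)) | inr j => s (proj1_sig j) end)).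
  { apply (Fstat D P P (fun p => proj1_sig p) (fun p => s (s (proj1_sig p)))
                 (fun p => s (proj1_sig p))); unfold P in *; rewrite ?R0, ?R1, ?R2; auto.
    - apply closed_ocl.
    - intros x Dx. split; [apply DA|apply DsA]; exact Dx.
    - exists (fun x => s (s x)). split; [exact Hss|]. split; [|reflexivity].
      intros x Dx. rewrite (HD x Dx). exact (HD x Dx). }
  destruct Stat as (t & Ht & _ & Est).
  destruct (aut_inverse _ _ t Ht) as (t' & Ht' & T1 & T2).
  (* For [x] in [A], [t] sends [x] to [s (s x)] and fixes [s x], so [t'] after [s] exchanges [x] and
     [s x]. *)
  exists (fun x => t' (s x)). split; [apply aut_comp; assumption|].
  intros x Ax. assert (E1 := Est (inl (exist _ x Ax))). assert (E2 := Est (inr (exist _ x Ax))).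
  simpl in E1, E2. split.
  - rewrite <- E2 at 1. apply T1.
  - rewrite <- E1. apply T1.
Qed.

(** The cycle is realized in [M] itself: automorphisms preserve formulas, so each edge satisfies
    every formula true of [(a 0, a 1)]. *)
Lemma cycle4_of_automorphisms (L : signature) (M : structure L) (k : nat) (a b : nat -> nat -> M) :
  (forall i, i < 4 -> exists s, is_aut M s /\ forall j, j < k ->
     s (a 0 j) = b i j /\ s (a 1 j) = b (S i mod 4) j) ->
  cycle_consistent M 4 k a.
Proof.
  intros H. exists M, b. split.
  - split; [exact (inhabits (a 0 0))|]. intros phi _ Hphi w. apply Hphi.
  - intros i Hi phi [Hfv Hphi]. destruct (H i Hi) as (s & Hs & E).
    rewrite <- (sat_aut _ M _ s (noparam M) phi Hs) in Hphi.
    replace (noparam M) with (fun p => s (noparam M p))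
      by (apply functional_extensionality; intros []).
    revert Hphi. apply sat_fv. intros [m j] Hx. apply Hfv in Hx. simpl in Hx.
    destruct Hx as [Hm Hj]. unfold tuple_val. simpl.
    destruct m as [|[|m]]; [symmetry; apply E, Hj ..|lia].
Qed.

Theorem theorem4p4 (L : signature) (M : structure L) :
  monster M -> free_amalgamation_theory M -> NSOP M 4.
Proof.
  intros Hmon [ind F] (k & a & Hind & Hnot). apply Hnot. clear Hnot.
  set (E := fun i => ocl L M (entries L M k a i)).
  assert (sE : forall i, small M (E i)).
  { intros i. apply small_ocl; [exact Hmon|apply countable_entries]. }
  assert (cE : forall i, closed M (E i)) by (intros; apply closed_ocl).
  assert (aE : forall i j, j < k -> E i (a i j)).
  { intros i j Hj. apply subset_ocl. exists j. auto. }
  destruct (shift_fixing_intersection L M k a Hmon Hind) as (tau & Htau & Dtau & T01 & T12).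
  fold (E 0) (E 1) in Dtau.
  set (D := inter M (E 0) (E 1)) in *.
  destruct (F) as (_ & _ & Fsym & _ & Fex & _ & Ffree & _).
  (* The tuple enumerates [E 2], and [rho] is the automorphism behind its equivalence with [a'] over
     [E 1]. *)
  destruct (Fex (E 1) (E 0) {x | E 2 x} (fun p => proj1_sig p)) as (a' & (rho & Hrho & Rfix & Ra) & Hfree);
    auto; [exact (sE 2)|].
  assert (Ea' : range M a' = image M rho (E 2)).
  { rewrite <- range_restrict. f_equal. apply functional_extensionality. intros p. symmetry. apply Ra. }
  rewrite Ea' in Hfree.
  (* [s] fixes [D] and maps [E 0] onto the image of [E 2] under [rho], the shape that [free_swap]
     asks for. *)
  pose (s := fun x => rho (tau (tau x))).
  assert (Hs : is_aut M s).
  { apply (aut_comp _ _ rho); [exact Hrho|]. apply aut_comp; assumption. }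
  assert (Ds : fixes M s D).
  { intros x Dx. unfold s. rewrite (Dtau x Dx), (Dtau x Dx). apply Rfix, Dx. }
  (* [tau] maps [E 0], [E 1] onto [E 1], [E 2], hence [D] onto the intersection of the latter two,
     and it fixes [D]. *)
  assert (E12 : forall x, E 1 x -> E 2 x -> D x).
  { intros x H1 H2.
    unfold E in H1, H2. rewrite <- (image_ocl_entries L M k a tau 0 1 Htau T01) in H1.
    rewrite <- (image_ocl_entries L M k a tau 1 2 Htau T12) in H2.
    destruct H1 as (y & Hy & Ey), H2 as (z & Hz & Ez).
    destruct (aut_inverse _ _ tau Htau) as (tau' & _ & T1 & _).
    assert (y = z) by (rewrite <- (T1 y), <- (T1 z); congruence). subst z.
    assert (Dy : D y) by (split; assumption).
    rewrite <- Ey, Dtau; exact Dy. }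
  assert (Es : image M s (E 0) = image M rho (E 2)).
  { unfold E. rewrite <- (image_ocl_entries L M k a tau 1 2 Htau T12).
    rewrite <- (image_ocl_entries L M k a tau 0 1 Htau T01).
    apply predicate_ext. intros y. split.
    - intros (x & Hx & <-). exists (tau (tau x)). split; [|reflexivity].
      exists (tau x). split; [|reflexivity]. exists x. auto.
    - intros (x2 & (x1 & (x & Hx & <-) & <-) & <-). exists x. auto. }
  assert (sD : small M D).
  { apply (small_subset _ _ _ (E 0)); [intros x [Hx _]; exact Hx|apply sE]. }
  assert (HfreeD : ind (image M s (E 0)) D (E 0)).
  { rewrite Es. apply (Ffree _ _ (E 1)); auto.
    - apply small_image, sE.
    (* A point [x = rho y] of [E 1] is fixed by [rho], so [x = y] lies in [E 2] and thus in [D]. *)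
    - intros x [H1 [(y & H2 & Ey)|H0]]; [|split; assumption].
      assert (x = y).
      { destruct (aut_inverse _ _ rho Hrho) as (rho' & _ & R1 & _).
        rewrite <- (R1 x), <- (R1 y), Ey. f_equal. apply Rfix, H1. }
      subst y. auto.
    - intros x [_ H1]. exact H1. }
  destruct (free_swap L M ind s (entries L M k a 0) D F Hs Ds) as (pi & Hpi & Hswap).
  { exact (sE 0). }
  { apply closed_inter; apply cE. }
  { intros x [H0 _]. exact H0. }
  { exact HfreeD. }
  assert (S2 : forall j, j < k -> s (a 0 j) = rho (a 2 j)).
  { intros j Hj. unfold s. rewrite T01, T12 by exact Hj. reflexivity. }
  assert (R1 : forall j, j < k -> rho (a 1 j) = a 1 j).
  { intros j Hj. apply Rfix, aE, Hj. }
  assert (P0 : forall j, j < k -> pi (a 0 j) = rho (a 2 j)).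
  { intros j Hj. rewrite <- S2 by exact Hj. apply Hswap, aE, Hj. }
  assert (P2 : forall j, j < k -> pi (rho (a 2 j)) = a 0 j).
  { intros j Hj. rewrite <- S2 by exact Hj. apply Hswap, aE, Hj. }
  apply (cycle4_of_automorphisms L M k a (fun i j => match i with
    | 0 => a 0 j | 1 => a 1 j | 2 => rho (a 2 j) | _ => pi (a 1 j) end)).
  intros i Hi. destruct i as [|[|[|[|i]]]]; [| | | |lia]; simpl.
  - exists (fun x => x). split; [apply aut_id|auto].
  - exists (fun x => rho (tau x)). split; [apply aut_comp; assumption|].
    intros j Hj. rewrite T01, T12 by exact Hj. auto.
  - exists pi. split; [exact Hpi|auto].
  (* The edge closing the cycle: [tau] then [rho] sends [(a 0, a 1)] to [(a 1, rho (a 2))], and [pi]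
     sends this to [(pi (a 1), a 0)]. *)
  - exists (fun x => pi (rho (tau x))).
    split; [apply (aut_comp _ _ pi); [exact Hpi|]; apply aut_comp; assumption|].
    intros j Hj. rewrite T01, T12 by exact Hj. rewrite R1 by exact Hj. auto.
Qed.
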